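(* Let $\theta_\ast>0$, $\sigma>0$, and $c=8\log(4\theta_\ast\sigma^{-2})$. Consider the Poisson mixture model in which $X_1,\dots,X_n$ are i.i.d. with probability mass function $h_Q(x)=\int_0^{\theta_\ast}\frac{e^{-\theta}\theta^x}{x!}\,\mathrm dQ(\theta)$, $x\in\mathbb Z^{\ge0}$, with $Q\in\mathcal P([0,\theta_\ast])$ unknown. Let $d$ be a generalized distance for which there exist constants $\gamma_3,\gamma_4>0$ with $\gamma_3H^2(p,q)\le d(p\Vert q)\le\gamma_4\chi^2(p\Vert q)$ for all $p,q\in\mathcal P(\mathbb Z^{\ge0})$, and let $\hat Q_d$ be any element of $\operatorname*{argmin}_{\tilde Q\in\mathcal P([0,\theta_\ast])}d(h^{\rm obs}\Vert h_{\tilde Q})$. Then $$\sup_{Q\in\mathcal P([0,\theta_\ast])}\mathbb E\,W_1^\sigma(Q,\hat Q_d)\le\begin{cases}C(\theta_\ast,\sigma^2,\gamma_3,\gamma_4)\cdot n^{-0.5+c/\log\log n}\,\mathrm{Polylog}(n), & \text{if } \sigma^2<4\theta_\ast,\\ C(\theta_\ast,\sigma^2,\gamma_3,\gamma_4)\cdot n^{-0.5}\,\mathrm{Polylog}(n), & \text{if } \sigma^2\ge4\theta_\ast,\end{cases}$$ where $C(\theta_\ast,\sigma^2,\gamma_3,\gamma_4)>0$ is a constant depending only on the indicated quantities.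
   Context: $\mathcal P(A)$ denotes the set of probability measures on $A$; $\mathbb Z^{\ge0}=\{0,1,2,\dots\}$. A generalized distance is a map $d:\mathcal P(\mathbb Z^{\ge0})\times\mathcal P(\mathbb Z^{\ge0})\to\mathbb R^{\ge0}$, written $d(p\Vert q)$, with $d(p\Vert q)=0$ iff $p=q$. $H^2(p,q)=\frac12\sum_{x\ge0}(\sqrt{p(x)}-\sqrt{q(x)})^2$ and $\chi^2(p\Vert q)=\sum_{x\ge0}(p(x)-q(x))^2/q(x)$. The empirical distribution is $h^{\rm obs}(x)=\frac1n\sum_{i=1}^n\mathbf 1(X_i=x)$. $W_1$ is the Wasserstein-1 distance and $W_1^\sigma(Q,Q')=W_1(Q\ast\mathcal N(0,\sigma^2),Q'\ast\mathcal N(0,\sigma^2))$, with $\ast$ denoting convolution. The expectation is over $X_1,\dots,X_n$ i.i.d. from $h_Q$. $\mathrm{Polylog}(n)$ denotes a factor of the form $(\log n)^a$ for some constant $a>0$ not depending on $n$; the bound is asserted for all sufficiently large $n$. *)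

(* Defs.v *)
From HB Require Import structures.
From mathcomp Require Import all_boot all_order all_algebra.
From mathcomp Require Import all_classical all_reals all_analysis.
Set Implicit Arguments. Unset Strict Implicit. Unset Printing Implicit Defensive.
Import Order.TTheory GRing.Theory Num.Theory.
Import numFieldNormedType.Exports.
Local Open Scope classical_set_scope.
Local Open Scope ring_scope.

Section defs.
Context {R : realType}.

Definition is_pmf (p : nat -> R) : Prop :=
  (forall x, 0 <= p x) /\ (\esum_(x in [set: nat]) (p x)%:E = 1)%E.

Definition hellinger2 (p q : nat -> R) : \bar R :=
  ((2^-1)%:E * \esum_(x in [set: nat]) ((Num.sqrt (p x) - Num.sqrt (q x)) ^+ 2)%:E)%E.

Definition chi2_term (p q : nat -> R) (x : nat) : \bar R :=
  if q x == 0 then (if p x == 0 then 0%E else +oo%E)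
  else (((p x - q x) ^+ 2) / q x)%:E.
Definition chi2 (p q : nat -> R) : \bar R :=
  (\esum_(x in [set: nat]) chi2_term p q x)%E.

Definition gen_distance (d : (nat -> R) -> (nat -> R) -> R) : Prop :=
  forall p q, is_pmf p -> is_pmf q ->
    0 <= d p q /\ (d p q = 0 <-> p = q).
Definition dist_sandwich (g3 g4 : R) (d : (nat -> R) -> (nat -> R) -> R) :=
  forall p q, is_pmf p -> is_pmf q ->
    (g3%:E * hellinger2 p q <= (d p q)%:E /\ (d p q)%:E <= g4%:E * chi2 p q)%E.

Definition Icc0 (th : R) : set R := `[0, th]%classic.

Definition supported_on (th : R) (Q : probability R R) : Prop :=
  Q (Icc0 th) = 1%E.

Definition hQ (th : R) (Q : probability R R) (x : nat) : R :=
  fine (\int[Q]_(t in (Icc0 th)) (expR (- t) * t ^+ x / (x`!)%:R)%:E)%E.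

Definition hobs (s : seq nat) (x : nat) : R :=
  (count_mem x s)%:R / (size s)%:R.

(* Gaussian smoothing: (Q * N(0, sig^2))(A) = int Q(dt) N(t, sig^2)(A) *)
Definition gconv (sig : R) (Q : probability R R) (A : set R) : \bar R :=
  (\int[Q]_(t in [set: R]) normal_prob t sig A)%E.

Definition is_coupling (mu nu : set R -> \bar R)
    (pi : probability (R * R)%type R) : Prop :=
  (forall A : set R, measurable A -> pi (A `*` [set: R]) = mu A) /\
  (forall B : set R, measurable B -> pi ([set: R] `*` B) = nu B).

Definition W1 (mu nu : set R -> \bar R) : \bar R :=
  ereal_inf [set (\int[pi]_(z in [set: (R * R)%type]) (`|z.1 - z.2|)%:E)%E
            | pi in is_coupling mu nu].

Definition W1sigma (sig : R) (Q Q' : probability R R) : \bar R :=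
  W1 (gconv sig Q) (gconv sig Q').

Definition expected_W1 (th sig : R) (n : nat) (Q : probability R R)
    (Qhat : n.-tuple nat -> probability R R) : \bar R :=
  (\esum_(s in [set: n.-tuple nat])
     (\prod_(i <- s) hQ th Q i)%:E * W1sigma sig Q (Qhat s))%E.

Definition is_min_d_estimator (th : R) (d : (nat -> R) -> (nat -> R) -> R)
    (n : nat) (Qhat : n.-tuple nat -> probability R R) : Prop :=
  forall s : n.-tuple nat,
    supported_on th (Qhat s) /\
    forall Q' : probability R R, supported_on th Q' ->
      d (hobs s) (hQ th (Qhat s)) <= d (hobs s) (hQ th Q').

End defs.

(* Main.v *)
Require Import Defs.
From HB Require Import structures.
From mathcomp Require Import all_boot all_order all_algebra.
From mathcomp Require Import all_classical all_reals all_analysis.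
From mathcomp Require Import measurable_realfun ring lra.
Set Implicit Arguments.
Unset Strict Implicit.
Import Order.TTheory GRing.Theory Num.Theory.
Import numFieldNormedType.Exports.
Local Open Scope classical_set_scope.
Local Open Scope ring_scope.

(* Coupling the common mass of two densities bounds W_1 by the integral of
   |y| |f - g|, so it suffices to compare the smoothed densities pointwise.  The
   Gaussian kernel is e^(-t) times a function of t; truncating the Taylor series
   of that function at order k turns the smoothed density into a combination of
   the values h_Q(m), m < 3k, whose coefficients amplify a Hellinger error by at
   most k^2 rho^(3k) with rho = max(1, 2 sqrt(theta) / sigma), up to a remainder
   D^k / sqrt(k!).  Minimality of the estimator and the sandwich hypothesis bound
   its Hellinger error by the chi-square distance of the empirical distribution
   to h_Q, which has mean O(log n / n) when no observation exceeds 2 log n.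
   Taking k = 5 log n / log log n makes the remainder smaller than n^(-1/2). *)

(** Two budgets fix the constants. In [y], the kernel leaves [e^(-y^2/(2 sig^2))], whereas both the
    amplification and the truncation remainder cost [e^((sig u)^2/4)] with [u = 1 + y/sig^2]. To
    leading order this spends half of the Gaussian decay; the other half pays for the linear term in
    [y] and for the weight [|y|]. In [n], write [L = log n] and [l = log log n]. The remainder drops
    to [n^(-1/2)] once [k >= 4 L/l]. In the case [sig^2 < 4 th], [rho^2 = e^(c/8)], so
    [rho^(3k) <= n^(c/l)] as long as [k <= (16/3) L/l]. The factor 5 lies between 4 and 16/3, with
    room for rounding [k] down. Only finitely many values of the mixture enter, each separately, so
    closeness of [sqrt (h x)] uniformly in [x] is enough. *)

(** * Finite measures given by a density *)

Section density_measure.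
Context d (T : measurableType d) (R : realType).
Variables (m : {measure set T -> \bar R}) (f : T -> R).
Hypotheses (f0 : forall x, 0 <= f x) (fi : m.-integrable setT (EFin \o f)).

(** The proofs are arguments so that the measure and finite-measure instances below find
    nonnegativity and integrability in the term itself. *)
Definition density (_ : forall x, 0 <= f x)
    (_ : m.-integrable setT (EFin \o f)) (A : set T) : \bar R :=
  (\int[m]_(x in A) (f x)%:E)%E.

Local Notation nu := (density f0 fi).

Let mf : measurable_fun [set: T] (fun x => (f x)%:E). Proof. exact: measurable_int fi. Qed.

Let density0 : nu set0 = 0%E. Proof. exact: integral_set0. Qed.

Let density_ge0 A : (0 <= nu A)%E.
Proof. by apply: integral_ge0 => x _; rewrite lee_fin. Qed.

Let density_sigma_additive : semi_sigma_additive nu.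
Proof.
move=> F mF tF mUF; rewrite /density ge0_integral_bigcup//=.
- by apply: is_cvg_ereal_nneg_natsum_cond => n _ _; exact: density_ge0.
- exact: measurable_funTS.
- by move=> x _; rewrite lee_fin.
Qed.

HB.instance Definition _ :=
  isMeasure.Build _ _ _ nu density0 density_ge0 density_sigma_additive.

Let density_fin : fin_num_fun nu.
Proof.
move=> A mA; rewrite ge0_fin_numE ?density_ge0//.
apply: (@le_lt_trans _ _ (\int[m]_x (f x)%:E)%E).
  by apply: ge0_subset_integral => // x _; rewrite lee_fin.
have /integrableP[_] := fi.
by under eq_integral do rewrite /= ger0_norm//.
Qed.

HB.instance Definition _ := @Measure_isFinite.Build _ _ _ nu density_fin.

Import HBNNSimple.

Let integral_density_nnsfun (g : {nnsfun T >-> R}) :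
  (\int[nu]_x (g x)%:E = \int[m]_x ((g x)%:E * (f x)%:E))%E.
Proof.
under [LHS]eq_integral do rewrite fimfunE -fsumEFin//.
rewrite [LHS]ge0_integral_fsum//; last 2 first.
  - by move=> r; exact/measurable_EFinP/measurableT_comp.
  - by move=> n x _; rewrite EFinM nnfun_muleindic_ge0.
under [RHS]eq_integral.
  move=> x xD; rewrite fimfunE -fsumEFin// ge0_mule_fsuml; last first.
    by move=> r; rewrite EFinM nnfun_muleindic_ge0.
  over.
rewrite [RHS]ge0_integral_fsum//; last 2 first.
  - move=> r; apply: emeasurable_funM => //.
    exact/measurable_EFinP/measurableT_comp.
  - move=> n x _; apply: mule_ge0; last by rewrite lee_fin.
    by rewrite EFinM nnfun_muleindic_ge0.
apply: eq_fsbigr => r _.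
rewrite integralZl_indic_nnsfun//= integral_indic// setIT.
have [r0|r0] := ltP r 0.
  rewrite preimage_nnfun0// measure0 mule0.
  by apply/esym/integral0_eq => x _; rewrite indic0 mulr0 mul0e.
under eq_integral do rewrite EFinM -muleA.
rewrite ge0_integralZl//; last 2 first.
- apply: emeasurable_funM => //.
  by apply/measurable_EFinP/measurable_indic.
- by move=> x _; rewrite mule_ge0 ?lee_fin.
congr (_ * _)%E.
rewrite [LHS]integral_mkcond.
by apply: eq_integral => x _; rewrite -EFinM patchE indicE;
  case: ifPn => _; rewrite ?mul1r ?mul0r.
Qed.

(** Simple functions approximate [g] from below; monotone convergence applies on both sides. *)
Lemma ge0_integral_density (g : T -> \bar R) :
  measurable_fun setT g -> (forall x, 0 <= g x)%E ->
  (\int[nu]_x g x = \int[m]_x (g x * (f x)%:E))%E.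
Proof.
move=> mg g0.
pose h := nnsfun_approx measurableT mg.
transitivity (lim (\int[nu]_x (h n x)%:E @[n --> \oo])%E).
  rewrite -monotone_convergence//=.
  - apply: eq_integral => ? /[!inE] xD; apply/esym/cvg_lim => //=.
    exact: cvg_nnsfun_approx.
  - by move=> n; exact/measurable_EFinP/measurable_funTS.
  - by move=> n ? _; rewrite lee_fin.
  - by move=> ? _ ? ? mn; rewrite lee_fin; exact/lefP/nd_nnsfun_approx.
under eq_fun do rewrite integral_density_nnsfun.
rewrite -monotone_convergence//=.
- apply: eq_integral => x /[!inE] xD; apply/cvg_lim => //=.
  by apply: cvgeZr => //; exact: cvg_nnsfun_approx.
- by move=> n; apply/emeasurable_funM => //; exact/measurable_EFinP.
- by move=> n x _; rewrite mule_ge0 ?lee_fin.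
- move=> x _ a b ab; rewrite lee_wpmul2r ?lee_fin//.
  exact/lefP/nd_nnsfun_approx.
Qed.

End density_measure.

(** * Coupling two densities through their overlap *)

Section overlap_coupling.
Context {R : realType}.
Local Notation leb := (@lebesgue_measure R).
Local Notation U := (measurableTypeR R).
Variables (f g : R -> R).
Hypotheses (f0 : forall x, 0 <= f x) (g0 : forall x, 0 <= g x).
Hypotheses (fi : leb.-integrable setT (EFin \o f))
  (gi : leb.-integrable setT (EFin \o g)).
Hypotheses (f1 : (\int[leb]_x (f x)%:E = 1)%E)
  (g1 : (\int[leb]_x (g x)%:E = 1)%E).

Let h x := Num.min (f x) (g x).
Let F x := f x - h x.
Let G x := g x - h x.

Let h0 x : 0 <= h x. Proof. by rewrite /h le_min f0 g0. Qed.
Let F0 x : 0 <= F x. Proof. by rewrite /F subr_ge0 /h ge_min lexx. Qed.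
Let G0 x : 0 <= G x. Proof. by rewrite /G subr_ge0 /h ge_min lexx orbT. Qed.

Let mf : measurable_fun setT f.
Proof. by apply/measurable_EFinP; exact: measurable_int fi. Qed.
Let mg : measurable_fun setT g.
Proof. by apply/measurable_EFinP; exact: measurable_int gi. Qed.
Let mh : measurable_fun setT h. Proof. exact: measurable_minr. Qed.
Let mF : measurable_fun setT F. Proof. exact: measurable_funB. Qed.
Let mG : measurable_fun setT G. Proof. exact: measurable_funB. Qed.

Let integrable_dom (u v : R -> R) : measurable_fun setT u ->
  (forall x, 0 <= u x) -> (forall x, u x <= v x) ->
  leb.-integrable setT (EFin \o v) -> leb.-integrable setT (EFin \o u).
Proof.
move=> mu u0 uv; apply: le_integrable => //; first exact/measurable_EFinP.
move=> x _; rewrite /= lee_fin ger0_norm// ger0_norm//.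
exact: le_trans (uv x).
Qed.

Let hi : leb.-integrable setT (EFin \o h).
Proof. by apply: integrable_dom fi => // x; rewrite ge_min lexx. Qed.
Let Fi : leb.-integrable setT (EFin \o F).
Proof. by apply: integrable_dom fi => // x; rewrite /F gerBl; exact: h0. Qed.
Let Gi : leb.-integrable setT (EFin \o G).
Proof. by apply: integrable_dom gi => // x; rewrite /G gerBl; exact: h0. Qed.

Local Notation dh := (@density _ _ R leb h h0 hi).
Local Notation dF := (@density _ _ R leb F F0 Fi).
Local Notation dG := (@density _ _ R leb G G0 Gi).

Let dhF A : measurable A -> (dh A + dF A = \int[leb]_(x in A) (f x)%:E)%E.
Proof.
move=> mA; rewrite /dh /dF /density -ge0_integralD//.
- by apply: eq_integral => x _; rewrite -EFinD /F addrC subrK.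
- by move=> x _; rewrite lee_fin.
- exact/measurable_EFinP/measurable_funTS.
- by move=> x _; rewrite lee_fin.
- exact/measurable_EFinP/measurable_funTS.
Qed.

Let dhG A : measurable A -> (dh A + dG A = \int[leb]_(x in A) (g x)%:E)%E.
Proof.
move=> mA; rewrite /dh /dG /density -ge0_integralD//.
- by apply: eq_integral => x _; rewrite -EFinD /G addrC subrK.
- by move=> x _; rewrite lee_fin.
- exact/measurable_EFinP/measurable_funTS.
- by move=> x _; rewrite lee_fin.
- exact/measurable_EFinP/measurable_funTS.
Qed.

(** The total variation distance of the two laws: as both have mass 1, the two excesses have this
    same mass. *)
Let m : R := fine (dF setT).

Let dFT : dF setT = m%:E.
Proof. by rewrite /m fineK// fin_num_measure. Qed.

Let dGT : dG setT = m%:E.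
Proof.
have hT : dh setT \is a fin_num by exact: fin_num_measure.
rewrite -dFT -(addeK (dG setT) hT) -(addeK (dF setT) hT).
by rewrite ![(_ + dh _)%E]addeC dhG// dhF// f1 g1.
Qed.

Let m0 : 0 <= m. Proof. exact: fine_ge0. Qed.

(** For [m = 0] the inverse is [0] by convention and [a] is squeezed to [0], so the normalisation of
    the product below needs no separate treatment of equal laws. *)
Let mVm (a : R) : 0 <= a -> a <= m -> m^-1 * (a * m) = a.
Proof.
move=> a0 am; have [mz|mz] := eqVneq m 0; last by rewrite mulrCA mulVf ?mulr1.
have -> : a = 0 by apply/le_anti; rewrite a0 -mz am.
by rewrite mul0r mulr0.
Qed.

Let mass_scale (mu : {finite_measure set U -> \bar R}) A : measurable A ->
  mu setT = m%:E -> (m^-1%:E * (mu A * m%:E) = mu A)%E.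
Proof.
move=> mA muT; have fA : mu A \is a fin_num by exact: fin_num_measure.
have : (mu A <= m%:E)%E by rewrite -muT le_measure ?inE.
have : (0 <= mu A)%E by [].
rewrite -(fineK fA) !lee_fin -!EFinM => a0 am; congr EFin; exact: mVm.
Qed.

Let mV0 : 0 <= m^-1. Proof. by rewrite invr_ge0. Qed.

Let diag (x : U) : U * U := (x, x).
Let mdiag : measurable_fun setT diag.
Proof. exact: measurable_fun_pair. Qed.

Local Notation push :=
  measure_function_pushforward__canonical__measure_function_Measure.

Let dia : {measure set (U * U) -> \bar R} := push dh mdiag.

(** The product of the excesses has marginals [m F] and [m G]; the factor [m^-1] restores [F] and
    [G]. *)
Let cplU : {measure set (U * U) -> \bar R} :=
  measure_add dia (mscale (NngNum mV0) (dF \x dG)%E).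

(* [U] and [R] carry the same Borel sets under two distinct displays, hence
   the pushforward along the identity. *)
Let toR (z : U * U) : R * R := (z.1 : R, z.2 : R).
Let mtoR : measurable_fun setT toR.
Proof. exact: measurable_fun_pair. Qed.

Let cpl : {measure set (R * R) -> \bar R} := push cplU mtoR.

Let cpl_l A : measurable A -> cpl (A `*` setT) = (\int[leb]_(x in A) (f x)%:E)%E.
Proof.
move=> mA; rewrite -[LHS]/(cplU (A `*` setT)) [LHS]measure_addE.
rewrite /= /mscale/= product_measure1E//.
rewrite [X in (_ * (_ * X))%E](_ : _ = m%:E); last exact: dGT.
rewrite [X in (_ + X)%E]mass_scale; [|exact: mA|exact: dFT].
rewrite -dhF//; congr (_ + _)%E.
by congr (dh _); apply/seteqP; split => x //= [].
Qed.

Let cpl_r A : measurable A -> cpl (setT `*` A) = (\int[leb]_(x in A) (g x)%:E)%E.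
Proof.
move=> mA; rewrite -[LHS]/(cplU (setT `*` A)) [LHS]measure_addE.
rewrite /= /mscale/= product_measure1E//.
rewrite [X in (_ * (X * _))%E](_ : _ = m%:E); last exact: dFT.
rewrite [(m%:E * _)%E]muleC.
rewrite [X in (_ + X)%E]mass_scale; [|exact: mA|exact: dGT].
rewrite -dhG//.
by congr (_ + _)%E; congr (dh _); apply/seteqP; split => x //= [].
Qed.

Let cplT : cpl setT = 1%E.
Proof. by rewrite -setXTT cpl_l. Qed.

Let cplP : probability (R * R)%type R :=
  HB.pack (Measure.sort cpl) (Measure_isProbability.Build _ _ _ cpl cplT).

Local Notation normE := measurable_EFinP.

Let mdist : measurable_fun [set: U * U] (fun z => (`|z.1 - z.2|)%:E).
Proof. by apply/normE; apply: measurableT_comp => //; exact: measurable_funB. Qed.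

Let mabs : measurable_fun [set: U] (fun y : U => (`|y|)%:E).
Proof. by apply/normE; apply: normr_measurable. Qed.

(** The diagonal part costs nothing. On the product part, [|x - y| <= |x| + |y|] separates the
    variables, each integral picking up the mass [m] of the other factor, which [m^-1] cancels.
    Finally [F + G = |f - g|], since at each point one of the excesses vanishes. *)
Let cpl_cost :
  (\int[cpl]_z (`|z.1 - z.2|)%:E <= \int[leb]_y (`|y| * `|f y - g y|)%:E)%E.
Proof.
rewrite /cpl ge0_integral_pushforward//= preimage_setT.
rewrite [leLHS]ge0_integral_measure_add//=.
rewrite ge0_integral_pushforward//=.
rewrite integral0_eq; last by move=> x _; rewrite /= subrr normr0.
rewrite add0e ge0_integral_mscale//=.
rewrite fubini_tonelli1//=.
have e0 (a : R) : (0 <= (`|a|)%:E)%E by rewrite lee_fin.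
apply: (@le_trans _ _ (m^-1%:E * (m%:E * (\int[dF]_y (`|y|)%:E +
    \int[dG]_y (`|y|)%:E)))%E).
  rewrite lee_wpmul2l ?lee_fin//.
  apply: (@le_trans _ _ (\int[dF]_x ((`|x|)%:E * m%:E +
      \int[dG]_y (`|y|)%:E))%E).
    apply: ge0_le_integral => //.
    - by move=> x _; apply: integral_ge0.
    - exact: (@measurable_fun_fubini_tonelli_F _ _ _ _ _ dG _ mdist).
    - by apply: emeasurable_funD => //; exact: emeasurable_funM.
    - move=> x _; rewrite /fubini_F/=.
      apply: (@le_trans _ _ (\int[dG]_y ((`|x|)%:E + (`|y|)%:E))%E).
        apply: ge0_le_integral => //.
        + by apply/normE; apply: measurableT_comp => //; exact: measurable_funB.
        + exact: emeasurable_funD.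
        + by move=> y _; rewrite -EFinD lee_fin ler_normB.
      by rewrite ge0_integralD// integral_cst// -dGT.
  rewrite ge0_integralD//; last 3 first.
  - by move=> x _; rewrite mule_ge0.
  - exact: emeasurable_funM.
  - by move=> *; apply: integral_ge0.
  have dFT' : (dF : {measure set U -> \bar R}) setT = m%:E := dFT.
  rewrite ge0_integralZr// integral_cst// dFT' ge0_muleDr ?integral_ge0//.
  by rewrite muleC [X in (_ + X <= _)%E]muleC.
(* An inequality, because [m^-1 * m] is [0] when [m = 0]. *)
apply: (@le_trans _ _ (\int[dF]_y (`|y|)%:E + \int[dG]_y (`|y|)%:E)%E).
  rewrite muleA -EFinM -[leRHS]mul1e; apply: lee_wpmul2r.
    by apply: adde_ge0; exact: integral_ge0.
  rewrite lee_fin.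
  by have [->|mz] := eqVneq m 0; [rewrite mulr0 ler01|rewrite mulVf].
rewrite !ge0_integral_density// -ge0_integralD//.
- apply: ge0_le_integral => //.
  + by move=> x _; rewrite adde_ge0// mule_ge0// lee_fin.
  + by apply: emeasurable_funD; apply: emeasurable_funM => //; exact/normE.
  + have mfg : measurable_fun [set: U] (fun y : U => `|f y - g y|).
      exact: (measurableT_comp (@normr_measurable R setT) (measurable_funB mf mg)).
    by apply/normE; apply: measurable_funM => //; exact: normr_measurable.
  + move=> x _; rewrite -!EFinM -EFinD lee_fin -mulrDr ler_wpM2l//.
    rewrite /F /G /h; have [fg|fg] := leP (f x) (g x).
      by rewrite subrr add0r ler0_norm ?opprB// subr_le0.
    by rewrite subrr addr0 ler_norm.
- by move=> x _; rewrite mule_ge0// lee_fin.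
- by apply: emeasurable_funM => //; exact/normE.
- by move=> x _; rewrite mule_ge0// lee_fin.
- by apply: emeasurable_funM => //; exact/normE.
Qed.

(* Couple by leaving the common mass min(f, g) in place and moving the two
   excesses, of equal mass, independently. *)
Lemma W1_le_overlap (mu nu : set R -> \bar R) :
  (forall A, measurable A -> mu A = \int[leb]_(x in A) (f x)%:E)%E ->
  (forall A, measurable A -> nu A = \int[leb]_(x in A) (g x)%:E)%E ->
  (W1 mu nu <= \int[leb]_y (`|y| * `|f y - g y|)%:E)%E.
Proof.
move=> muE nuE; apply: (le_trans _ cpl_cost); apply: ereal_inf_lbound.
exists cplP => //; split => A mA.
- by rewrite muE//= cpl_l.
- by rewrite nuE//= cpl_r.
Qed.

End overlap_coupling.

(** * Densities of Gaussian-smoothed laws *)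

Section gaussian_smoothing.
Context {R : realType}.
Local Notation leb := (@lebesgue_measure R).
Local Notation U := (measurableTypeR R).
Variables (sig : R) (sig0 : 0 < sig).

Let pdfE t (y : R) : normal_pdf t sig y = normal_peak sig * normal_fun t sig y.
Proof. by rewrite normal_pdfE ?gt_eqF. Qed.

Let measurable_pdf2 :
  measurable_fun [set: R * U] (fun z => (normal_pdf z.1 sig (z.2 : R))%:E).
Proof.
apply/measurable_EFinP; under eq_fun do rewrite pdfE.
apply: measurable_funM => //; apply: measurableT_comp => //.
apply: measurable_funM => //; apply: measurableT_comp => //.
by apply: measurable_funX; apply: measurable_funB.
Qed.

Definition smoothed_pdf (Q : probability R R) (y : R) : R :=
  \int[Q]_t normal_pdf t sig y.

Lemma measurable_normal_pdfl (y : R) :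
  measurable_fun [set: R] (fun t => normal_pdf t sig y).
Proof.
under eq_fun do rewrite pdfE.
apply: measurable_funM => //; apply: measurableT_comp => //.
apply: measurable_funM => //; apply: measurableT_comp => //.
by apply: measurable_funX; apply: measurable_funB.
Qed.

Lemma smoothed_pdfE (Q : probability R R) (y : R) :
  (smoothed_pdf Q y)%:E = (\int[Q]_t (normal_pdf t sig y)%:E)%E.
Proof.
rewrite /smoothed_pdf /Rintegral fineK// ge0_fin_numE; last first.
  by apply: integral_ge0 => t _; rewrite lee_fin normal_pdf_ge0.
apply: (@le_lt_trans _ _ (\int[Q]_t (normal_peak sig)%:E)%E); last first.
  by rewrite integral_cst//= [X in (_ * X)%E]probability_setT mule1 ltry.
apply: ge0_le_integral => //.
- by move=> t _; rewrite lee_fin normal_pdf_ge0.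
- by apply/measurable_EFinP; exact: measurable_normal_pdfl.
- by move=> t _; rewrite lee_fin normal_pdf_ub ?gt_eqF.
Qed.

Lemma smoothed_pdf_ge0 (Q : probability R R) (y : R) : 0 <= smoothed_pdf Q y.
Proof. by apply: Rintegral_ge0 => t _; exact: normal_pdf_ge0. Qed.

Lemma gconv_density (Q : probability R R) (A : set R) : measurable A ->
  gconv sig Q A = (\int[leb]_(y in A) (smoothed_pdf Q y)%:E)%E.
Proof.
move=> mA; rewrite /gconv /normal_prob.
pose F (z : R * U) := ((normal_pdf z.1 sig (z.2 : R))%:E * (\1_A (z.2 : R))%:E)%E.
have mI : measurable_fun [set: U] (fun y : U => (\1_A (y : R))%:E : \bar R).
  by apply/measurable_EFinP; exact: (@measurable_indic _ R R setT A mA).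
have mF : measurable_fun setT F.
  apply: emeasurable_funM => //.
  exact: (measurableT_comp mI (measurable_snd : measurable_fun [set: R * U] _)).
have F0 z : (0 <= F z)%E by rewrite mule_ge0// lee_fin ?normal_pdf_ge0.
have := @fubini_tonelli _ _ _ _ R Q leb F mF F0.
rewrite /F /=.
under eq_integral.
  move=> t _.
  rewrite (_ : integral _ _ _ = \int[leb]_(y in A) (normal_pdf t sig y)%:E)%E; last first.
    rewrite [RHS]integral_mkcond; apply: eq_integral => y _.
    by rewrite patchE indicE; case: ifP => _; rewrite ?mule1 ?mule0.
  over.
move=> ->; rewrite [RHS]integral_mkcond; apply: eq_integral => y _.
rewrite patchE indicE; case: ifP => _.
  by under eq_integral do rewrite mule1; rewrite smoothed_pdfE.
by apply: integral0_eq => t _; rewrite mule0.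
Qed.

Lemma integral_smoothed_pdf (Q : probability R R) :
  (\int[leb]_y (smoothed_pdf Q y)%:E = 1)%E.
Proof.
rewrite -(@gconv_density Q setT)// /gconv.
rewrite /normal_prob; under eq_integral do rewrite integral_normal_pdf.
rewrite integral_cst// mul1e; exact: probability_setT.
Qed.

Lemma measurable_smoothed_pdf (Q : probability R R) :
  measurable_fun [set: U] (smoothed_pdf Q).
Proof.
apply/measurable_EFinP; rewrite /comp; under eq_fun do rewrite smoothed_pdfE.
have pdf0 (z : R * U) : (0 <= (normal_pdf z.1 sig (z.2 : R))%:E)%E.
  by rewrite lee_fin normal_pdf_ge0.
exact: (@measurable_fun_fubini_tonelli_G _ _ _ _ R Q _ measurable_pdf2 pdf0).
Qed.

Lemma integrable_smoothed_pdf (Q : probability R R) :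
  leb.-integrable setT (EFin \o smoothed_pdf Q).
Proof.
apply/integrableP; split.
  by apply/measurable_EFinP; exact: measurable_smoothed_pdf.
under eq_integral do rewrite /= ger0_norm ?smoothed_pdf_ge0//.
by rewrite integral_smoothed_pdf ltry.
Qed.

Lemma W1sigma_le (Q Q' : probability R R) :
  (W1sigma sig Q Q' <=
   \int[leb]_y (`|y| * `|smoothed_pdf Q y - smoothed_pdf Q' y|)%:E)%E.
Proof.
apply: W1_le_overlap.
- exact: smoothed_pdf_ge0.
- exact: smoothed_pdf_ge0.
- exact: integrable_smoothed_pdf.
- exact: integrable_smoothed_pdf.
- exact: integral_smoothed_pdf.
- exact: integral_smoothed_pdf.
- exact: gconv_density.
- exact: gconv_density.
Qed.

End gaussian_smoothing.

(** * Truncated exponential series and factorial estimates *)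

Section exponential_truncation.
Context {R : realType}.
Implicit Types (x : R) (k : nat).

Lemma fact_dvd_bound i j : (i`! * j`! <= (i + j)`!)%N.
Proof.
by rewrite -(@bin_fact (i + j) i) ?leq_addr// addKn leq_pmull// bin_gt0 leq_addr.
Qed.

(** A binomial coefficient is at most the sum [2^(i+j)] of its row. *)
Lemma fact_le_exp2 i j : ((i + j)`! <= 2 ^ (i + j) * (i`! * j`!))%N.
Proof.
rewrite -(@bin_fact (i + j) i) ?leq_addr// addKn leq_mul2r orbC.
rewrite -(add1n 1) expnDn (bigD1 (inord i))//= inordK ?ltnS ?leq_addr//.
by rewrite !exp1n !muln1 leq_addr.
Qed.

Definition expR_trunc k x : R := \sum_(i < k) x ^+ i / (i`!)%:R.

Let trunc_cvg x : expR_trunc^~ x @ \oo --> expR x.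
Proof.
have -> : expR_trunc^~ x = series (exp_coeff x).
  by apply/funext => k; rewrite /expR_trunc /series/= big_mkord.
exact: is_cvg_series_exp_coeff.
Qed.

Lemma expR_trunc_le k x : 0 <= x -> expR_trunc k x <= expR x.
Proof.
move=> x0; rewrite -(cvg_lim _ (@trunc_cvg x))//.
apply: nondecreasing_cvgn_le; last by apply/cvg_ex; exists (expR x); exact: trunc_cvg.
apply/nondecreasing_seqP => n; rewrite /expR_trunc big_ord_recr/= lerDl.
by rewrite divr_ge0 ?exprn_ge0.
Qed.

Lemma norm_expR_trunc_le k x : `|expR_trunc k x| <= expR `|x|.
Proof.
apply: le_trans (expR_trunc_le k (normr_ge0 x)).
apply: le_trans (ler_norm_sum _ _ _) _; apply: ler_sum => i _.
by rewrite normrM normrX normfV normr_nat.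
Qed.

Lemma expR_ge_term k x : 0 <= x -> x ^+ k / (k`!)%:R <= expR x.
Proof.
move=> x0; apply: le_trans (expR_trunc_le k.+1 x0).
rewrite /expR_trunc big_ord_recr/= lerDr sumr_ge0// => i _.
by rewrite divr_ge0 ?exprn_ge0.
Qed.

(** Since [(k + i)! >= k! i!], the tail factors as [|x|^k / k!] times a partial sum of [e^|x|]. The
    estimate is made on finite sums and passed to the limit. *)
Lemma expR_remainder k x :
  `|expR x - expR_trunc k x| <= `|x| ^+ k / (k`!)%:R * expR `|x|.
Proof.
have cv : `|expR_trunc (n + k)%N x - expR_trunc k x| @[n --> \oo] -->
    `|expR x - expR_trunc k x|.
  apply: cvg_norm; apply: cvgB; last exact: cvg_cst.
  by rewrite (cvg_shiftn k (expR_trunc^~ x)); exact: trunc_cvg.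
rewrite -(cvg_lim _ cv)//; apply: limr_le.
  by apply/cvg_ex; exists `|expR x - expR_trunc k x|; exact: cv.
apply: nearW => n.
rewrite addnC (_ : expR_trunc (k + n) x = expR_trunc k x +
    \sum_(i < n) x ^+ (k + i) / ((k + i)`!)%:R); last first.
  by rewrite /expR_trunc big_split_ord.
rewrite addrC addKr.
apply: le_trans (ler_norm_sum _ _ _) _.
apply: (@le_trans _ _ (`|x| ^+ k / (k`!)%:R * expR_trunc n `|x|)); last first.
  by rewrite ler_wpM2l ?expR_trunc_le// divr_ge0 ?exprn_ge0.
rewrite /expR_trunc mulr_sumr; apply: ler_sum => i _.
rewrite normrM normrX normfV normr_nat exprD mulrACA ler_wpM2l//.
by rewrite -invfM lef_pV2 ?posrE ?mulr_gt0 ?ltr0n ?fact_gt0// -natrM ler_nat fact_dvd_bound.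
Qed.

(** Squared, the left side is the [k]-th term of the series of [e^(x^2)]. *)
Lemma exp_sqrt_fact_le k x : 0 <= x ->
  x ^+ k / Num.sqrt (k`!)%:R <= expR (x ^+ 2 / 2).
Proof.
move=> x0; rewrite -ler_sqr ?nnegrE ?expR_ge0 ?divr_ge0 ?exprn_ge0 ?sqrtr_ge0//.
rewrite exprMn exprVn sqr_sqrtr// -exprM mulnC exprM -expRM_natl.
rewrite (_ : 2%:R * (x ^+ 2 / 2) = x ^+ 2); last by field.
by apply: expR_ge_term; rewrite sqr_ge0.
Qed.

(** Two binomial bounds: [(i + 2j)! <= 2^(i+2j) i! (2j)!] and [(2j)! <= 4^j (j!)^2]. *)
Lemma sqrt_factD i j : Num.sqrt ((i + 2 * j)`!)%:R <=
  (Num.sqrt 2) ^+ i * Num.sqrt (i`!)%:R * (4 ^+ j * (j`!)%:R) :> R.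
Proof.
have e : (Num.sqrt 2 ^+ i * Num.sqrt (i`!)%:R * (4 ^+ j * (j`!)%:R)) ^+ 2 =
   ((2 ^ (i + 2 * j) * (i`! * (2 ^ (2 * j) * (j`! * j`!))))%N)%:R :> R.
  have a2 : (Num.sqrt 2 ^+ i) ^+ 2 = 2 ^+ i :> R.
    by rewrite -exprM mulnC exprM sqr_sqrtr.
  have b2 : Num.sqrt (i`!)%:R ^+ 2 = (i`!)%:R :> R by rewrite sqr_sqrtr.
  have c4 : 2 ^+ (2 * j) = 4 ^+ j :> R by rewrite exprM -natrX.
  rewrite !natrM !natrX exprD c4 !exprMn a2 b2; ring.
rewrite -ler_sqr ?nnegrE ?sqrtr_ge0 ?mulr_ge0 ?exprn_ge0 ?sqrtr_ge0//.
rewrite e sqr_sqrtr// ler_nat.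
apply: leq_trans (fact_le_exp2 _ _) _; rewrite leq_mul2l leq_mul2l.
apply/orP; right; apply/orP; right.
by rewrite mul2n -addnn fact_le_exp2.
Qed.

(* A coefficient of the product of truncations of [e^(tu)] and
   [e^(-t^2/(2s^2))] will multiply [m! (h(m) - h'(m))] with [m = i + 2j], and
   Hellinger closeness only gives [h(m) - h'(m) = O((m!)^(-1/2))]: hence the
   factor [sqrt m!]. *)
Lemma hermite_coef_le (s u : R) i j : 0 < s ->
  `|u| ^+ i / (i`!)%:R * ((2 * s ^+ 2)^-1 ^+ j / (j`!)%:R) *
    Num.sqrt ((i + 2 * j)`!)%:R <=
  (2 / s) ^+ (i + 2 * j) * expR ((s * u) ^+ 2 / 4).
Proof.
move=> s0.
apply: (@le_trans _ _ (`|u| ^+ i / (i`!)%:R * ((2 * s ^+ 2)^-1 ^+ j / (j`!)%:R) *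
   ((Num.sqrt 2) ^+ i * Num.sqrt (i`!)%:R * (4 ^+ j * (j`!)%:R)))).
  rewrite ler_wpM2l ?sqrt_factD// mulr_ge0 ?divr_ge0 ?exprn_ge0//.
  by rewrite invr_ge0 mulr_ge0 ?sqr_ge0.
(* Chosen so that [(2/s) w = sqrt 2 |u|], which matches the powers of index [i], and
   [w^2/2 = (s u)^2/4], which is the exponent allowed. The powers of index [j] only need
   [2/s^2 <= (2/s)^2]. *)
set w := s * `|u| / Num.sqrt 2.
have w0 : 0 <= w by rewrite /w divr_ge0 ?sqrtr_ge0// mulr_ge0// ltW.
have q0 : Num.sqrt (2 : R) != 0 by rewrite sqrtr_eq0 -ltNge.
have q2 : Num.sqrt (2 : R) ^+ 2 = 2 by rewrite sqr_sqrtr.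
have f0 n : Num.sqrt (n`!)%:R != 0 :> R.
  by rewrite sqrtr_eq0 -ltNge ltr0n fact_gt0.
have -> : `|u| ^+ i / (i`!)%:R * ((2 * s ^+ 2)^-1 ^+ j / (j`!)%:R) *
   ((Num.sqrt 2) ^+ i * Num.sqrt (i`!)%:R * (4 ^+ j * (j`!)%:R)) =
   (2 / s) ^+ i * (2 / s ^+ 2) ^+ j * (w ^+ i / Num.sqrt (i`!)%:R).
  have fi0 : Num.sqrt (i`!)%:R ^+ 2 = (i`!)%:R :> R by rewrite sqr_sqrtr.
  have ew : (2 / s) ^+ i * w ^+ i = `|u| ^+ i * Num.sqrt 2 ^+ i.
    rewrite -!exprMn /w; congr (_ ^+ i); rewrite -{1}q2.
    by field; rewrite q0 gt_eqF.
  have eb : (2 * s ^+ 2)^-1 ^+ j * 4 ^+ j = (2 / s ^+ 2) ^+ j.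
    by rewrite -exprMn; congr (_ ^+ j); field; rewrite gt_eqF.
  have j0 : ((j`!)%:R : R) != 0 by rewrite pnatr_eq0 -lt0n fact_gt0.
  have -> : (2 / s) ^+ i * (2 / s ^+ 2) ^+ j * (w ^+ i / Num.sqrt (i`!)%:R) =
      (2 / s) ^+ i * w ^+ i * (2 / s ^+ 2) ^+ j / Num.sqrt (i`!)%:R by ring.
  have alg (a b z r t q : R) : q != 0 -> z != 0 ->
      a / q ^+ 2 * (b / z) * (r * q * (t * z)) = a * r * (b * t) / q.
    by move=> ? ?; field; apply/andP; split.
  by rewrite ew -eb -{1}fi0; exact: alg.
have wE : expR (w ^+ 2 / 2) = expR ((s * u) ^+ 2 / 4).
  congr expR; rewrite /w !exprMn exprVn q2 -normrX ger0_norm ?sqr_ge0//.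
  by field.
rewrite -wE; apply: ler_pM.
- by rewrite mulr_ge0// exprn_ge0// divr_ge0 ?sqr_ge0// ltW.
- by rewrite divr_ge0 ?exprn_ge0 ?sqrtr_ge0.
- rewrite exprD ler_wpM2l ?exprn_ge0 ?divr_ge0 ?(ltW s0)//.
  rewrite exprM lerXn2r ?nnegrE ?exprn_ge0 ?divr_ge0 ?sqr_ge0 ?(ltW s0)//.
  by rewrite exprMn exprVn ler_wpM2r ?invr_ge0 ?sqr_ge0// expr2; lra.
- exact: exp_sqrt_fact_le.
Qed.

End exponential_truncation.

(** * Integrals against laws supported on [[0, th]] *)

Section supported_integrals.
Context {R : realType}.
Variables (th : R) (Q : probability R R) (sQ : supported_on th Q).

Lemma measurable_Icc0 : measurable (Icc0 th).
Proof. exact: measurable_itv. Qed.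

Local Hint Resolve measurable_Icc0 : core.

Lemma Icc0P t : Icc0 th t <-> 0 <= t <= th.
Proof. by rewrite /Icc0 /= in_itv. Qed.

Lemma supported_integralT (f : R -> \bar R) :
  measurable_fun setT f -> (forall t, 0 <= f t)%E ->
  (\int[Q]_t f t = \int[Q]_(t in Icc0 th) f t)%E.
Proof.
move=> mf f0; rewrite -(setUv (Icc0 th)) ge0_integral_setU//=; last 3 first.
- exact: measurableC.
- by rewrite setUv.
- by apply/disj_setPS => x [].
rewrite [X in (_ + X)%E](_ : _ = 0%E) ?adde0//.
apply: null_set_integral => //; first exact: measurableC.
- exact: measurable_funTS.
- transitivity (1 - Q (Icc0 th))%E; first exact: probability_setC.
  by rewrite sQ subee.
Qed.

Lemma supported_integrable (f : R -> R) (B : R) : measurable_fun setT f ->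
  (forall t, 0 <= t <= th -> `|f t| <= B) ->
  Q.-integrable (Icc0 th) (EFin \o f).
Proof.
move=> mf fB; apply: measurable_bounded_integrable => //.
- by rewrite (le_lt_trans (probability_le1 _ _))// ltry.
- exact: measurable_funTS.
- exists B; split; first by rewrite num_real.
  by move=> x Bx t /Icc0P t0; exact: le_trans (fB _ t0) (ltW Bx).
Qed.

Lemma supported_Rintegral_near (f g : R -> R) (B e : R) :
  measurable_fun setT f -> measurable_fun setT g ->
  (forall t, 0 <= t <= th -> `|f t| <= B) ->
  (forall t, 0 <= t <= th -> `|f t - g t| <= e) ->
  `|\int[Q]_(t in Icc0 th) f t - \int[Q]_(t in Icc0 th) g t| <= e.
Proof.
move=> mf mg fB fge.
have fi := supported_integrable mf fB.
have gi : Q.-integrable (Icc0 th) (EFin \o g).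
  apply: (@supported_integrable g (B + e)) => // t t0.
  rewrite -[g t](subKr (f t)) (le_trans (ler_normB _ _))// lerD ?fge ?fB//.
have fgi : Q.-integrable (Icc0 th) (EFin \o (fun t => f t - g t)).
  by apply: (@supported_integrable _ e) => //; exact: measurable_funB.
rewrite -RintegralB//.
apply: le_trans (le_normr_Rintegral _ fgi) _ => //.
have -> : e = \int[Q]_(t in Icc0 th) (cst e) t.
  by rewrite Rintegral_cst// [X in fine X]sQ mulr1.
apply: le_Rintegral => //; first exact: integrable_norm.
by apply: (@supported_integrable _ `|e|).
Qed.

End supported_integrals.

Lemma Rintegral_sum d (T : measurableType d) (R : realType)
    (mu : {measure set T -> \bar R}) (D : set T) (mD : measurable D)
    (I : Type) (s : seq I) (F : I -> T -> R) :
  (forall i, mu.-integrable D (EFin \o F i)) ->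
  \int[mu]_(x in D) (\sum_(i <- s) F i x) =
  \sum_(i <- s) \int[mu]_(x in D) F i x.
Proof.
move=> Fi; elim: s => [|i s IHs].
  under eq_Rintegral do rewrite big_nil.
  by rewrite Rintegral_cst// mul0r big_nil.
under eq_Rintegral do rewrite big_cons.
rewrite RintegralD// ?IHs ?big_cons//.
rewrite (_ : _ \o _ = (fun x => \sum_(j <- s) (F j x)%:E)%E); last first.
  by apply/funext => x /=; rewrite sumEFin.
by apply: integrable_sum => // j _; exact: Fi.
Qed.

(** * Poisson mixtures *)

Section poisson_mixture.
Context {R : realType}.
Variables (th : R) (th0 : 0 < th).

Local Notation pois t x := (expR (- t) * t ^+ x / (x`!)%:R).

Lemma measurable_pois x : measurable_fun setT (fun t : R => pois t x).
Proof.
apply: measurable_funM => //; apply: measurable_funM => //.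
by apply: measurableT_comp => //; exact: measurableT_comp.
Qed.

Lemma pois_ge0 (t : R) x : 0 <= t -> 0 <= pois t x.
Proof. by move=> t0; rewrite !mulr_ge0 ?expR_ge0 ?exprn_ge0. Qed.

Lemma pois_le (t : R) x : 0 <= t <= th -> pois t x <= th ^+ x / (x`!)%:R.
Proof.
move=> /andP[t0 tth]; rewrite ler_wpM2r ?invr_ge0// -[leRHS]mul1r.
rewrite ler_pM ?expR_ge0 ?exprn_ge0//.
  by rewrite -expR0 ler_expR oppr_le0.
by rewrite lerXn2r ?nnegrE ?(le_trans t0).
Qed.

Variables (Q : probability R R) (sQ : supported_on th Q).

Lemma integrable_pois x : Q.-integrable (Icc0 th) (fun t => (pois t x)%:E).
Proof.
apply: (@supported_integrable R th Q (fun t => pois t x) (th ^+ x / (x`!)%:R)).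
  exact: measurable_pois.
by move=> t /andP[t0 tth]; rewrite ger0_norm ?pois_ge0// pois_le ?t0.
Qed.

Lemma hQ_EFin x : (hQ th Q x)%:E = (\int[Q]_(t in Icc0 th) (pois t x)%:E)%E.
Proof.
rewrite /hQ fineK//; apply: integrable_fin_num; last exact: integrable_pois.
exact: measurable_Icc0.
Qed.

Lemma hQ_ge0 x : 0 <= hQ th Q x.
Proof.
by apply: Rintegral_ge0 => t /Icc0P/andP[t0 _]; exact: pois_ge0.
Qed.

Lemma hQ_le x : hQ th Q x <= th ^+ x / (x`!)%:R.
Proof.
have -> : th ^+ x / (x`!)%:R = \int[Q]_(t in Icc0 th) (cst (th ^+ x / (x`!)%:R)) t.
  by rewrite Rintegral_cst ?[X in fine X]sQ ?mulr1//; exact: measurable_Icc0.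
apply: le_Rintegral; first exact: measurable_Icc0.
- exact: integrable_pois.
- by apply: (@supported_integrable _ _ _ _ `|th ^+ x / (x`!)%:R|).
- by move=> t /Icc0P; exact: pois_le.
Qed.

Lemma expR_nneseries (t : R) : 0 <= t ->
  (\sum_(x <oo) (pois t x)%:E = 1)%E.
Proof.
move=> t0; apply/cvg_lim => //.
rewrite (_ : (fun n => _) = EFin \o (fun n => expR (- t) * series (exp_coeff t) n)).
  apply/cvg_EFin; first exact: nearW.
  rewrite /comp/= -[X in _ --> X](_ : expR (- t) * expR t = _).
    apply: cvgMr; exact: is_cvg_series_exp_coeff.
  by rewrite mulrC expRxMexpNx_1.
apply/funext => n /=; rewrite sumEFin; congr EFin.
by rewrite /series/= mulr_sumr; apply: eq_bigr => i _; rewrite mulrA.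
Qed.

Lemma hQ_pmf : is_pmf (hQ th Q).
Proof.
split; first exact: hQ_ge0.
rewrite -nneseries_esumT; last by move=> x; rewrite lee_fin hQ_ge0.
under eq_eseriesr do rewrite hQ_EFin.
rewrite -integral_nneseries//=.
- transitivity (\int[Q]_(t in Icc0 th) (1 : \bar R))%E.
    apply: eq_integral => t /[!inE] /Icc0P/andP[t0 _]; exact: expR_nneseries.
  by rewrite integral_cst ?mul1e//; exact: measurable_Icc0.
- exact: measurable_Icc0.
- by move=> n; apply/measurable_EFinP/measurable_funTS; exact: measurable_pois.
- by move=> n t /Icc0P/andP[t0 _]; rewrite lee_fin pois_ge0.
Qed.

Lemma hQ_le1 x : hQ th Q x <= 1.
Proof.
have [_ h1] := hQ_pmf; rewrite -lee_fin -h1.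
rewrite -nneseries_esumT; last by move=> ?; rewrite lee_fin hQ_ge0.
apply: le_trans (nneseries_lim_ge x.+1 _); last by move=> ? _; rewrite lee_fin hQ_ge0.
rewrite big_mkord big_ord_recr/= leeDr// sume_ge0// => i _.
by rewrite lee_fin hQ_ge0.
Qed.

End poisson_mixture.

(** * Factoring the Gaussian kernel and truncating it *)

Section smoothed_pdf_difference.
Context {R : realType}.
Variables (th sig : R) (th0 : 0 < th) (sig0 : 0 < sig).

Local Notation tilt y := (1 + y / sig ^+ 2).
Local Notation prec := ((2 * sig ^+ 2)^-1).
Local Notation base y := (normal_peak sig * expR (- (y ^+ 2) * prec)).

(* The tilt [e^(-t)] that turns monomials in [t] into multiples of Poisson
   probabilities is split off, and compensated in [tilt]. *)
Lemma normal_pdf_factor (y t : R) : normal_pdf t sig y =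
  base y * (expR (- t) * (expR (t * tilt y) * expR (- (prec * t ^+ 2)))).
Proof.
rewrite normal_pdfE ?gt_eqF//.
rewrite -[LHS]/(normal_peak sig * normal_fun t sig y) -mulrA; congr (_ * _).
rewrite /normal_fun -!expRD; congr expR.
by field; rewrite gt_eqF.
Qed.

Let prec0 : 0 < prec. Proof. by rewrite invr_gt0 mulr_gt0// exprn_gt0. Qed.

(* The two summands control the truncations of [e^(tu)], where part of
   [(th |u|)^k / k!] is absorbed in a Gaussian factor, and of
   [e^(-t^2/(2 sig^2))]. *)
Definition trunc_base : R := 2 * th / sig + th ^+ 2 / (2 * sig ^+ 2).
Definition trunc_const : R :=
  2 * expR (2 * th ^+ 2 / sig ^+ 2 + th ^+ 2 / (2 * sig ^+ 2)).

Lemma trunc_base_gt0 : 0 < trunc_base.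
Proof.
by rewrite addr_gt0// divr_gt0 ?mulr_gt0 ?exprn_gt0// mulr_gt0.
Qed.

(** With [w = sig |u| / 2] and [d = 2 th / sig], [|t u| <= d w]. One factor [sqrt k!] of the
    remainder turns [w^k] into at most [e^(w^2/2)], and [d w <= w^2/2 + d^2/2] bounds the
    exponential factor; together they use exactly [e^(w^2) = e^((sig u)^2/4)]. The other [sqrt k!]
    stays as the gain. The second series has a bounded argument and costs only constants. *)
Lemma trunc_err (y t : R) k : 0 <= t <= th ->
  `|expR (t * tilt y) * expR (- (prec * t ^+ 2)) -
    expR_trunc k (t * tilt y) * expR_trunc k (- (prec * t ^+ 2))| <=
  trunc_const * expR ((sig * tilt y) ^+ 2 / 4) *
    (trunc_base ^+ k / Num.sqrt (k`!)%:R).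
Proof.
move=> /andP[t0 tth]; set u := tilt y; set w := sig * `|u| / 2.
have w0 : 0 <= w by rewrite divr_ge0 ?mulr_ge0 ?(ltW sig0).
have wE : (sig * u) ^+ 2 / 4 = w ^+ 2.
  by rewrite /w !exprMn -normrX ger0_norm ?sqr_ge0//; field.
set d := 2 * th / sig; set b := th ^+ 2 / (2 * sig ^+ 2).
have d0 : 0 < d by rewrite divr_gt0 ?mulr_gt0.
have b0 : 0 < b by rewrite divr_gt0 ?exprn_gt0 ?mulr_gt0 ?exprn_gt0.
set f := Num.sqrt (k`!)%:R.
have f1 : 1 <= f :> R.
  by rewrite -sqrtr1 ler_sqrt ?ler0n// (ler_nat R 1) fact_gt0.
have f0 : 0 < f by rewrite (lt_le_trans ltr01).
have fE : (k`!)%:R = f ^+ 2 :> R by rewrite sqr_sqrtr.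
have tu : `|t * u| <= d * w.
  have -> : d * w = th * `|u| by rewrite /d /w; field; rewrite gt_eqF.
  by rewrite normrM ler_wpM2r// ger0_norm.
have bt : `|- (prec * t ^+ 2)| <= b.
  rewrite normrN ger0_norm ?mulr_ge0 ?sqr_ge0 ?(ltW prec0)// mulrC.
  by rewrite ler_wpM2r ?(ltW prec0)// lerXn2r ?nnegrE ?(ltW th0).
have e1 : expR `|t * u| <= expR (w ^+ 2 / 2 + 2 * th ^+ 2 / sig ^+ 2).
  rewrite ler_expR (le_trans tu)//.
  have -> : 2 * th ^+ 2 / sig ^+ 2 = d ^+ 2 / 2.
    by rewrite /d; field; rewrite gt_eqF.
  have := sqr_ge0 (w - d); rewrite sqrrB !expr2; lra.
have r1 : `|expR (t * u) - expR_trunc k (t * u)| <=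
    d ^+ k / f * expR (w ^+ 2 + 2 * th ^+ 2 / sig ^+ 2).
  apply: le_trans (expR_remainder _ _) _.
  apply: (@le_trans _ _ ((d * w) ^+ k / f ^+ 2 *
      expR (w ^+ 2 / 2 + 2 * th ^+ 2 / sig ^+ 2))).
    rewrite -fE ler_pM ?expR_ge0 ?divr_ge0 ?exprn_ge0// ler_wpM2r ?invr_ge0//.
    by rewrite lerXn2r ?nnegrE// mulr_ge0// ltW.
  have -> : (d * w) ^+ k / f ^+ 2 * expR (w ^+ 2 / 2 + 2 * th ^+ 2 / sig ^+ 2) =
      d ^+ k / f * ((w ^+ k / f) * expR (w ^+ 2 / 2 + 2 * th ^+ 2 / sig ^+ 2)).
    by rewrite exprMn; field; rewrite gt_eqF.
  rewrite ler_wpM2l ?divr_ge0 ?exprn_ge0 ?(ltW d0) ?(ltW f0)//.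
  have -> : w ^+ 2 + 2 * th ^+ 2 / sig ^+ 2 =
    w ^+ 2 / 2 + (w ^+ 2 / 2 + 2 * th ^+ 2 / sig ^+ 2) by field; rewrite gt_eqF.
  by rewrite [leRHS]expRD ler_wpM2r ?expR_ge0// exp_sqrt_fact_le.
have r2 : `|expR (- (prec * t ^+ 2)) - expR_trunc k (- (prec * t ^+ 2))| <=
    b ^+ k / f * expR b.
  apply: le_trans (expR_remainder _ _) _.
  apply: ler_pM; rewrite ?expR_ge0 ?divr_ge0 ?exprn_ge0 ?ler_expR//.
  apply: ler_pM; rewrite ?invr_ge0 ?exprn_ge0//.
    by rewrite lerXn2r ?nnegrE// ltW.
  by rewrite fE lef_pV2 ?posrE ?exprn_gt0// expr2 ler_peMl// ltW.
set E := expR (t * u) in r1 *; set F := expR (- _) in r2 *.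
set T := expR_trunc k (t * u) in r1 *.
set S := expR_trunc k (- _) in r2 *.
(* Telescoping: [F <= 1] since its exponent is nonpositive, and [T] is dominated by [e^|t u|]. *)
have -> : E * F - T * S = (E - T) * F + T * (F - S) by ring.
apply: le_trans (ler_normD _ _) _; rewrite !normrM.
have F1 : `|F| <= 1.
  by rewrite ger0_norm ?expR_ge0// -expR0 ler_expR oppr_le0 mulr_ge0 ?sqr_ge0// ltW.
have T1 : `|T| <= expR (w ^+ 2 / 2 + 2 * th ^+ 2 / sig ^+ 2).
  exact: le_trans (norm_expR_trunc_le _ _) e1.
set c := 2 * th ^+ 2 / sig ^+ 2 in e1 r1 T1 *.
have D1 : d ^+ k <= trunc_base ^+ k.
  by rewrite lerXn2r ?nnegrE ?(ltW d0) ?(ltW trunc_base_gt0)// lerDl ltW.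
have D2 : b ^+ k <= trunc_base ^+ k.
  by rewrite lerXn2r ?nnegrE ?(ltW b0) ?(ltW trunc_base_gt0)// lerDr ltW.
have e2 : expR (w ^+ 2 + c) <= expR (w ^+ 2 + (c + b)).
  by rewrite ler_expR addrA lerDl ltW.
have e3 : expR (w ^+ 2 / 2 + c) * expR b <= expR (w ^+ 2 + (c + b)).
  rewrite -expRD ler_expR; have := sqr_ge0 w; lra.
rewrite wE /trunc_const -/c -/b.
have -> : 2 * expR (c + b) * expR (w ^+ 2) * (trunc_base ^+ k / f) =
    trunc_base ^+ k / f * expR (w ^+ 2 + (c + b)) +
    trunc_base ^+ k / f * expR (w ^+ 2 + (c + b)) by rewrite !expRD; ring.
apply: lerD.
  apply: (@le_trans _ _ (d ^+ k / f * expR (w ^+ 2 + c))).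
    by rewrite -[leRHS]mulr1 ler_pM.
  by rewrite ler_pM ?expR_ge0 ?divr_ge0 ?exprn_ge0 ?(ltW d0) ?(ltW f0)// ler_wpM2r ?invr_ge0// ltW.
apply: (@le_trans _ _ (expR (w ^+ 2 / 2 + c) * (b ^+ k / f * expR b))).
  by rewrite ler_pM.
rewrite mulrCA ler_pM ?divr_ge0 ?mulr_ge0 ?expR_ge0 ?exprn_ge0 ?(ltW b0) ?(ltW f0)//.
by rewrite ler_wpM2r ?invr_ge0// ltW.
Qed.

End smoothed_pdf_difference.

(** * From closeness of the mixtures to closeness of the smoothed densities *)

Section smoothed_pdf_hellinger.
Context {R : realType}.
Variables (th sig : R) (th0 : 0 < th) (sig0 : 0 < sig).

Local Notation tilt y := (1 + y / sig ^+ 2).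
Local Notation prec := ((2 * sig ^+ 2)^-1).
Local Notation base y := (normal_peak sig * expR (- (y ^+ 2) * prec)).
Local Notation pois t x := (expR (- t) * t ^+ x / (x`!)%:R).

Let base_ge0 y : 0 <= base y.
Proof. by rewrite mulr_ge0 ?normal_peak_ge0 ?expR_ge0. Qed.

Let deg k (p : 'I_k * 'I_k) : nat := (p.1 + 2 * p.2)%N.

(** The factor [(deg p)!] converts the monomial [e^(-t) t^m] into the Poisson probability of
    [m = deg p]. *)
Let coef k (y : R) (p : 'I_k * 'I_k) : R :=
  base y * (tilt y ^+ p.1 / (p.1`!)%:R * ((- prec) ^+ p.2 / (p.2`!)%:R)) *
    ((deg p)`!)%:R.

Let pdf_trunc k (y t : R) : R := \sum_(p : 'I_k * 'I_k) coef y p * pois t (deg p).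

Let pdf_truncE k (y t : R) : pdf_trunc k y t = base y * (expR (- t) *
  (expR_trunc k (t * tilt y) * expR_trunc k (- (prec * t ^+ 2)))).
Proof.
rewrite /expR_trunc big_distrlr/= pair_bigA/= !mulr_sumr; apply: eq_bigr => p _.
have -> : (t * tilt y) ^+ p.1 = t ^+ p.1 * tilt y ^+ p.1 by exact: exprMn.
have -> : (- (prec * t ^+ 2)) ^+ p.2 = (- prec) ^+ p.2 * t ^+ (2 * p.2).
  by rewrite -mulNr exprM; exact: exprMn.
rewrite /coef /deg exprD.
have f0 : (((p.1 + 2 * p.2)%N)`!)%:R != 0 :> R by rewrite pnatr_eq0 -lt0n fact_gt0.
have f1 : ((p.1)`!)%:R != 0 :> R by rewrite pnatr_eq0 -lt0n fact_gt0.
have f2 : ((p.2)`!)%:R != 0 :> R by rewrite pnatr_eq0 -lt0n fact_gt0.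
move: (- prec) (tilt y) (base y) (expR _) f0 f1 f2 => a b c e.
move: (a ^+ _) (b ^+ _) (t ^+ _) (t ^+ _) (_%:R) (_%:R) (_%:R) => *.
by field; do ![apply/andP; split].
Qed.

Lemma smoothed_pdf_Icc0 (Q : probability R R) y : supported_on th Q ->
  smoothed_pdf sig Q y = \int[Q]_(t in Icc0 th) normal_pdf t sig y.
Proof.
move=> sQ; rewrite /smoothed_pdf /Rintegral (supported_integralT sQ)//.
- by apply/measurable_EFinP; exact: measurable_normal_pdfl.
- by move=> t; rewrite lee_fin normal_pdf_ge0.
Qed.

Let measurable_pdf_trunc k y : measurable_fun setT (pdf_trunc k y).
Proof.
apply: measurable_sum => p; apply: measurable_funM => //.
exact: measurable_pois.
Qed.

Let smoothed_pdf_near (Q : probability R R) k y : supported_on th Q ->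
  `|smoothed_pdf sig Q y - \int[Q]_(t in Icc0 th) pdf_trunc k y t| <=
  base y * expR ((sig * tilt y) ^+ 2 / 4) *
   (trunc_const th sig * (trunc_base th sig ^+ k / Num.sqrt (k`!)%:R)).
Proof.
move=> sQ; rewrite smoothed_pdf_Icc0//.
apply: (@supported_Rintegral_near _ _ _ sQ _ _ (normal_peak sig)).
- exact: measurable_normal_pdfl.
- exact: measurable_pdf_trunc.
- by move=> t _; rewrite ger0_norm ?normal_pdf_ge0 ?normal_pdf_ub ?gt_eqF.
- move=> t t0th; rewrite normal_pdf_factor// pdf_truncE -!mulrBr.
  rewrite normrM ger0_norm// -mulrA ler_wpM2l// normrM ger0_norm ?expR_ge0//.
  rewrite [leRHS]mulrCA [leRHS]mulrA -[leRHS]mul1r ler_pM ?expR_ge0//.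
    by rewrite -expR0 ler_expR oppr_le0; case/andP: t0th.
  exact: trunc_err.
Qed.

Let integral_pdf_trunc (Q : probability R R) k y : supported_on th Q ->
  \int[Q]_(t in Icc0 th) pdf_trunc k y t =
  \sum_(p : 'I_k * 'I_k) coef y p * hQ th Q (deg p).
Proof.
move=> sQ; rewrite /pdf_trunc.
have ip x : Q.-integrable (Icc0 th) (EFin \o (fun t => pois t x)).
  exact: integrable_pois.
rewrite Rintegral_sum; last 2 first.
- exact: measurable_Icc0.
- by move=> p; apply: integrableZl (ip _); exact: measurable_Icc0.
apply: eq_bigr => p _; rewrite RintegralZl//; exact: measurable_Icc0.
Qed.

Variables (Q Q' : probability R R).
Hypotheses (sQ : supported_on th Q) (sQ' : supported_on th Q').
Variables (rho eps : R).
Hypotheses (rho1 : 1 <= rho) (rhoE : 2 * Num.sqrt th / sig <= rho).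
Hypothesis (hQQ' : forall x,
  `|Num.sqrt (hQ th Q x) - Num.sqrt (hQ th Q' x)| <= eps).

(** Factor [a - b] as a difference times a sum of square roots. The sum supplies the decay
    [(x!)^(-1/2)] that leaves only [sqrt (deg p)!] of the factorial in [coef]. *)
Lemma hQ_diff x :
  `|hQ th Q x - hQ th Q' x| <= 2 * eps * Num.sqrt (th ^+ x / (x`!)%:R).
Proof.
have c0 : 0 <= th ^+ x / (x`!)%:R by rewrite divr_ge0 ?exprn_ge0 ?(ltW th0).
rewrite -[X in X - _]sqr_sqrtr ?hQ_ge0// -[X in _ - X]sqr_sqrtr ?hQ_ge0//.
rewrite subr_sqr normrM -mulrA mulrCA ler_pM//.
rewrite ger0_norm ?addr_ge0 ?sqrtr_ge0//.
rewrite mulr_natl mulr2n; apply: lerD; rewrite ler_sqrt//; exact: hQ_le.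
Qed.

(** There are [k^2] terms, of degree [m <= 3k]. Each contributes [(2/sig)^m (sqrt th)^m <= rho^m],
    and [rho >= 1] allows raising [m] to [3k] uniformly. *)
Let main_diff k y :
  `|\sum_(p : 'I_k * 'I_k) coef y p * hQ th Q (deg p) -
    \sum_(p : 'I_k * 'I_k) coef y p * hQ th Q' (deg p)| <=
  base y * expR ((sig * tilt y) ^+ 2 / 4) *
    (2 * (k%:R ^+ 2 * rho ^+ (3 * k) * eps)).
Proof.
have eps0 : 0 <= eps by exact: le_trans (normr_ge0 _) (hQQ' 0).
set W := base y * _.
have W0 : 0 <= W by rewrite mulr_ge0 ?expR_ge0.
rewrite -sumrB; apply: le_trans (ler_norm_sum _ _ _) _.
have -> : W * (2 * (k%:R ^+ 2 * rho ^+ (3 * k) * eps)) =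
    \sum_(p : 'I_k * 'I_k) W * (2 * rho ^+ (3 * k) * eps).
  rewrite sumr_const card_prod card_ord -[RHS]mulr_natr natrM.
  by move: W (rho ^+ _) (k%:R : R) {W0} => V r n; rewrite expr2; ring.
apply: ler_sum => p _; rewrite -mulrBr normrM.
set m := deg p.
have m3 : (m <= 3 * k)%N.
  have l1 : (p.1 <= k)%N by rewrite ltnW.
  have l2 : (2 * p.2 <= 2 * k)%N by rewrite leq_mul2l ltnW.
  exact: leq_add l1 l2.
have fm : 0 < ((m`!)%:R : R) by rewrite ltr0n fact_gt0.
have cE : `|coef y p| * Num.sqrt (th ^+ m / (m`!)%:R) =
   base y * (`|tilt y| ^+ p.1 / (p.1`!)%:R *
     (prec ^+ p.2 / (p.2`!)%:R) * Num.sqrt (m`!)%:R) * Num.sqrt th ^+ m.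
  have prec0 : 0 < prec by rewrite invr_gt0 mulr_gt0// exprn_gt0.
  rewrite /coef -/m normrM normr_nat normrM (ger0_norm (base_ge0 _)).
  rewrite normrM !normf_div !normrX normrN !normr_nat (gtr0_norm prec0).
  rewrite sqrtrM ?exprn_ge0 ?(ltW th0)// sqrtrV ?ler0n//.
  have -> : Num.sqrt (th ^+ m) = Num.sqrt th ^+ m.
    elim: (m) => [|n IH]; first by rewrite !expr0 sqrtr1.
    by rewrite !exprS sqrtrM ?(ltW th0)// IH.
  have q0 : Num.sqrt (m`!)%:R != 0 :> R by rewrite sqrtr_eq0 -ltNge.
  have {1}-> : (m`!)%:R = Num.sqrt (m`!)%:R ^+ 2 :> R by rewrite sqr_sqrtr// ltW.
  have alg (a b c q : R) : q != 0 -> a * b * q ^+ 2 * (c / q) = a * (b * q) * c.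
    by move=> ?; field.
  exact: alg.
apply: (@le_trans _ _ (`|coef y p| * (2 * eps * Num.sqrt (th ^+ m / (m`!)%:R)))).
  by rewrite ler_wpM2l// hQ_diff.
rewrite mulrCA cE.
have := @hermite_coef_le R sig (tilt y) p.1 p.2 sig0; rewrite -/(deg p) -/m => H.
have r : (2 / sig) ^+ m * Num.sqrt th ^+ m <= rho ^+ (3 * k).
  rewrite -exprMn mulrAC.
  apply: (@le_trans _ _ (rho ^+ m)).
    rewrite lerXn2r ?nnegrE ?(le_trans ler01 rho1)//.
    by rewrite divr_ge0 ?mulr_ge0 ?sqrtr_ge0 ?(ltW sig0).
  by rewrite ler_weXn2l.
have -> : W * (2 * rho ^+ (3 * k) * eps) =
  2 * eps * (base y * (expR ((sig * tilt y) ^+ 2 / 4) * rho ^+ (3 * k))).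
  by rewrite /W; move: (base y) (expR _) (rho ^+ _) => a b r'; ring.
rewrite ler_wpM2l ?mulr_ge0// -mulrA ler_wpM2l//.
apply: (@le_trans _ _ ((2 / sig) ^+ m * expR ((sig * tilt y) ^+ 2 / 4) *
   Num.sqrt th ^+ m)).
  by rewrite ler_wpM2r ?exprn_ge0 ?sqrtr_ge0.
by rewrite mulrAC mulrC ler_wpM2l ?expR_ge0.
Qed.

Lemma smoothed_pdf_diff k y :
  `|smoothed_pdf sig Q y - smoothed_pdf sig Q' y| <=
  base y * expR ((sig * tilt y) ^+ 2 / 4) *
    (2 * (k%:R ^+ 2 * rho ^+ (3 * k) * eps) +
     2 * (trunc_const th sig * (trunc_base th sig ^+ k / Num.sqrt (k`!)%:R))).
Proof.
have n1 := smoothed_pdf_near k y sQ.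
have n2 := smoothed_pdf_near k y sQ'.
have := main_diff k y.
rewrite !integral_pdf_trunc// in n1 n2.
set W := base y * _ in n1 n2 *; set E := trunc_const _ _ * _ in n1 n2 *.
move: n1 n2; set a := smoothed_pdf _ _ _; set b := smoothed_pdf _ _ _.
set a' := \sum_(p : _) _; set b' := \sum_(p : _) _ => n1 n2 mn.
have -> : a - b = (a' - b') + ((a - a') - (b - b')) by ring.
rewrite mulrDr; apply: le_trans (ler_normD _ _) _; apply: lerD => //.
apply: le_trans (ler_normB _ _) _; rewrite mulrCA mulr_natl mulr2n.
by apply: lerD.
Qed.

End smoothed_pdf_hellinger.

(** * Integrating the pointwise bound *)

Section W1sigma_hellinger.
Context {R : realType}.
Variables (th sig : R) (th0 : 0 < th) (sig0 : 0 < sig).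
Local Notation leb := (@lebesgue_measure R).
Local Notation U := (measurableTypeR R).

Local Notation tilt y := (1 + y / sig ^+ 2).
Local Notation prec := ((2 * sig ^+ 2)^-1).
Local Notation base y := (normal_peak sig * expR (- (y ^+ 2) * prec)).

Let tail_const : R := (4 * sig ^+ 2 + 1) * normal_peak sig *
  expR (3 * sig ^+ 2 / 4) / normal_peak (3 * sig).

Let tail_const_ge0 : 0 <= tail_const.
Proof.
rewrite /tail_const !mulr_ge0 ?expR_ge0 ?normal_peak_ge0 ?invr_ge0//.
by rewrite addr_ge0// mulr_ge0// sqr_ge0.
Qed.

(** With [x = y^2/(16 sig^2)], the exponent is at most a constant minus [2x] after completing the
    square, which absorbs the linear term. The weight [|y|] costs at most a constant times [e^x].
    The remaining [e^(-x)] is below the profile [e^(-(16/18) x)] of a normal law of standard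
    deviation [3 sig], whose density integrates to 1. *)
Lemma weight_le (y : R) :
  `|y| * (base y * expR ((sig * tilt y) ^+ 2 / 4)) <=
  tail_const * normal_pdf 0 (3 * sig) y.
Proof.
have wide0 : 0 < 3 * sig by rewrite mulr_gt0.
set x := y ^+ 2 / (16 * sig ^+ 2).
have x0 : 0 <= x by rewrite divr_ge0 ?sqr_ge0// mulr_ge0 ?sqr_ge0.
have s1 : sig != 0 by rewrite gt_eqF.
have yx : `|y| <= (4 * sig ^+ 2 + 1) * expR x.
  have h : `|y| <= 4 * sig ^+ 2 + x.
    have <- : (`|y| / (4 * sig) - 2 * sig) ^+ 2 + `|y| = 4 * sig ^+ 2 + x.
      rewrite /x -(ger0_norm (sqr_ge0 y)) normrX; field.
      by rewrite s1.
    by rewrite lerDr sqr_ge0.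
  apply: le_trans h _.
  have e1 := expR_ge1Dx x.
  have e2 : 0 <= sig ^+ 2 * (expR x - 1) by rewrite mulr_ge0 ?sqr_ge0//; lra.
  by move: (expR x) (sig ^+ 2) e1 e2 => e s e1 e2; lra.
have bE : base y * expR ((sig * tilt y) ^+ 2 / 4) <=
   normal_peak sig * (expR (3 * sig ^+ 2 / 4) * expR (- (2 * x))).
  rewrite -mulrA ler_wpM2l ?normal_peak_ge0// -!expRD ler_expR.
  have -> : - (y ^+ 2) * prec + (sig * tilt y) ^+ 2 / 4 =
     3 * sig ^+ 2 / 4 - 2 * x - (y / sig - 2 * sig) ^+ 2 / 8.
    by rewrite /x; field; rewrite s1.
  by rewrite gerDl oppr_le0 divr_ge0 ?sqr_ge0.
have pdfE : normal_pdf 0 (3 * sig) y = normal_peak (3 * sig) *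
    expR (- (16 / 18 * x)).
  rewrite normal_pdfE ?gt_eqF//.
  rewrite -[LHS]/(normal_peak (3 * sig) * normal_fun 0 (3 * sig) y).
  by congr (_ * _); rewrite /normal_fun; congr expR; rewrite /x; field; rewrite s1.
have p0 : normal_peak (3 * sig) != 0 by rewrite gt_eqF// normal_peak_gt0 ?gt_eqF.
apply: (@le_trans _ _ ((4 * sig ^+ 2 + 1) * expR x *
   (normal_peak sig * (expR (3 * sig ^+ 2 / 4) * expR (- (2 * x)))))).
  by rewrite ler_pM// mulr_ge0 ?expR_ge0// mulr_ge0 ?expR_ge0 ?normal_peak_ge0.
rewrite pdfE /tail_const.
have -> (a b c e f : R) : a * e * (b * (c * f)) = a * b * c * (e * f) by ring.
rewrite [leRHS]mulrA divfK// ler_wpM2l//.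
  rewrite !mulr_ge0 ?expR_ge0 ?normal_peak_ge0//.
  by rewrite addr_ge0// mulr_ge0// sqr_ge0.
rewrite -expRD ler_expR; lra.

Qed.

Definition W1sigma_const : R := tail_const * (2 + 2 * trunc_const th sig) + 1.

Lemma W1sigma_const_gt0 : 0 < W1sigma_const.
Proof.
rewrite ltr_wpDl// mulr_ge0 ?tail_const_ge0// addr_ge0// mulr_ge0//.
by rewrite mulr_ge0 ?expR_ge0.
Qed.

Lemma W1sigma_le_hellinger (Q Q' : probability R R) (rho eps : R) k :
  supported_on th Q -> supported_on th Q' ->
  1 <= rho -> 2 * Num.sqrt th / sig <= rho ->
  (forall x, `|Num.sqrt (hQ th Q x) - Num.sqrt (hQ th Q' x)| <= eps) ->
  (W1sigma sig Q Q' <=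
   (W1sigma_const * (k%:R ^+ 2 * rho ^+ (3 * k) * eps +
     trunc_base th sig ^+ k / Num.sqrt (k`!)%:R))%:E)%E.
Proof.
move=> sQ sQ' rho1 rhoE hQQ'.
have eps0 : 0 <= eps by exact: le_trans (normr_ge0 _) (hQQ' 0).
apply: le_trans (W1sigma_le sig0 Q Q') _.
set a := k%:R ^+ 2 * _ * _; set b := _ / Num.sqrt _.
have a0 : 0 <= a.
  by rewrite !mulr_ge0 ?exprn_ge0 ?(le_trans ler01 rho1).
have b0 : 0 <= b.
  by rewrite divr_ge0 ?sqrtr_ge0 ?exprn_ge0 ?(ltW (trunc_base_gt0 _ _)).
have tc0 : 0 <= trunc_const th sig by rewrite mulr_ge0 ?expR_ge0.
pose X := 2 * a + 2 * (trunc_const th sig * b).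
have X0 : 0 <= X by apply: addr_ge0; apply: mulr_ge0 => //; apply: mulr_ge0.
have mpdf : measurable_fun [set: U] (fun y : U => normal_pdf 0 (3 * sig) (y : R)).
  exact: (measurable_normal_pdf (0 : R) (3 * sig)).
apply: (@le_trans _ _ (\int[leb]_y ((tail_const * X)%:E *
    (normal_pdf 0 (3 * sig) y)%:E))%E).
  apply: ge0_le_integral => //.
  - apply/measurable_EFinP; apply: measurable_funM => //.
    have mfg : measurable_fun [set: U]
        (fun y : U => smoothed_pdf sig Q y - smoothed_pdf sig Q' y).
      by apply: (@measurable_funB _ U); exact: measurable_smoothed_pdf.
    exact: (measurableT_comp (@normr_measurable R setT) mfg).
  - by apply: emeasurable_funM => //; exact/measurable_EFinP.
  - move=> y _; rewrite -EFinM lee_fin.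
    have := smoothed_pdf_diff th0 sig0 sQ sQ' rho1 rhoE hQQ' k y.
    rewrite -/a -/b -/X => dy.
    apply: le_trans (ler_wpM2l (normr_ge0 y) dy) _.
    rewrite mulrA [leRHS]mulrAC; apply: ler_wpM2r X0 _ _ _; exact: weight_le.
rewrite ge0_integralZl//; last 3 first.
- exact/measurable_EFinP.
- by move=> y _; rewrite lee_fin normal_pdf_ge0.
- by rewrite lee_fin mulr_ge0.
rewrite integral_normal_pdf mule1 lee_fin /W1sigma_const mulrDl -[leLHS]addr0.
apply: lerD; last by rewrite mul1r addr_ge0.
rewrite -mulrA ler_wpM2l//.
have := mulr_ge0 tc0 a0; rewrite /X; nra.
Qed.

End W1sigma_hellinger.

(** * Means under independent sampling *)

Section iid_means.
Context {R : realType}.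

Lemma esumZl_le (T : choiceType) (a : T -> \bar R) (c : R) : 0 <= c ->
  (forall i, 0 <= a i)%E ->
  (\esum_(i in [set: T]) (c%:E * a i) <= c%:E * \esum_(i in [set: T]) a i)%E.
Proof.
move=> c0 a0; apply: ge_ereal_sup => _ [X [finX XI]] <-.
rewrite -ge0_mule_fsumr//; apply: lee_wpmul2l; first by rewrite lee_fin.
by apply: ereal_sup_ubound; exists X.
Qed.

Variables (p : nat -> R) (pP : is_pmf p).

Let p0 x : 0 <= p x. Proof. by case: pP. Qed.

Let pT : (\esum_(x in [set: nat]) (p x)%:E = 1)%E. Proof. by case: pP. Qed.

Definition iid_weight (s : seq nat) : R := \prod_(i <- s) p i.

Lemma iid_weight_ge0 s : 0 <= iid_weight s.
Proof. exact: prodr_ge0. Qed.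

(* The mean of [F] under [n] independent draws from [p] is at most [c]. *)
Definition mean_le n (F : seq nat -> R) (c : R) : Prop :=
  (\esum_(s in [set: n.-tuple nat]) (iid_weight s * F s)%:E <= c%:E)%E.

Lemma mean_le0 F c : 0 <= F [::] -> F [::] <= c -> mean_le 0 F c.
Proof.
move=> F0 Fc; rewrite /mean_le.
have -> : [set: 0.-tuple nat] = [set [tuple]].
  by apply/seteqP; split => // s _; rewrite /= [s]tuple0.
have w1 : iid_weight [tuple] = 1 by rewrite /iid_weight big_nil.
by rewrite esum_set1 w1 mul1r lee_fin.
Qed.

Lemma mean_le_mono n F G c d : (forall s, F s <= G s) -> c <= d ->
  mean_le n G c -> mean_le n F d.
Proof.
move=> FG cd; rewrite /mean_le => Gc.
apply: (@le_trans _ _ c%:E); last by rewrite lee_fin.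
apply: le_trans Gc; apply: le_esum => s _.
by rewrite lee_fin ler_wpM2l// iid_weight_ge0.
Qed.

Lemma mean_leD n F G c d : (forall s, 0 <= F s) -> (forall s, 0 <= G s) ->
  mean_le n F c -> mean_le n G d -> mean_le n (fun s => F s + G s) (c + d).
Proof.
move=> F0 G0 Fc Gd; rewrite /mean_le; under eq_esum do rewrite mulrDr EFinD.
rewrite esumD ?EFinD ?leeD// => s _; rewrite lee_fin mulr_ge0//;
  exact: iid_weight_ge0.
Qed.

Lemma mean_leZ n F c a : 0 <= a -> (forall s, 0 <= F s) ->
  mean_le n F c -> mean_le n (fun s => a * F s) (a * c).
Proof.
move=> a0 F0 Fc; rewrite /mean_le; under eq_esum do rewrite mulrCA EFinM.
apply: le_trans (esumZl_le a0 _) _.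
  by move=> s; rewrite lee_fin mulr_ge0// iid_weight_ge0.
by rewrite EFinM lee_wpmul2l// lee_fin.
Qed.

(** Conditioning on the first draw: the induction step for the bounds on constants, exceedances and
    counts below. *)
Lemma mean_leS n F (c : nat -> R) C : (forall s, 0 <= F s) ->
  (forall x, mean_le n (fun s => F (x :: s)) (c x)) ->
  (\esum_(x in [set: nat]) (p x * c x)%:E <= C%:E)%E -> mean_le n.+1 F C.
Proof.
move=> F0 Fc cC; apply: le_trans cC; rewrite /mean_le.
pose e (z : nat * n.-tuple nat) : n.+1.-tuple nat := [tuple of z.1 :: z.2].
rewrite (@reindex_esum _ _ _ [set: nat * n.-tuple nat] setT e); last first.
  split => //.
  - move=> [x s] [y t] _ _ /(congr1 val)/= [-> st].
    by congr pair; apply/val_inj.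
  - by move=> s _; exists (thead s, [tuple of behead s]) => //; rewrite [RHS]tuple_eta.
pose a x (s : n.-tuple nat) := ((p x)%:E * (iid_weight s * F (x :: s))%:E)%E.
have a0 x s : (0 <= a x s)%E.
  by rewrite /a mule_ge0 ?lee_fin// mulr_ge0// iid_weight_ge0.
have -> : [set: nat * n.-tuple nat] =
    [set: nat] `*`` (fun=> [set: n.-tuple nat]) by apply/seteqP; split.
rewrite (eq_esum (b := fun z => a z.1 z.2)); last first.
  by move=> [x s] _; rewrite /a -EFinM /iid_weight /e/= big_cons mulrA.
rewrite -(@esum_esum _ _ _ setT (fun=> setT) a)//.
apply: le_esum => x _; apply: le_trans (esumZl_le (p0 x) _) _.
  by move=> s; rewrite lee_fin mulr_ge0// iid_weight_ge0.
by rewrite EFinM lee_wpmul2l// ?lee_fin//; exact: Fc.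
Qed.

Lemma pmf_mean_cst (c : R) : 0 <= c ->
  (\esum_(x in [set: nat]) (p x * c)%:E <= c%:E)%E.
Proof.
move=> c0; under eq_esum do rewrite mulrC EFinM.
apply: le_trans (esumZl_le c0 _) _; first by move=> x; rewrite lee_fin.
by rewrite pT mule1.
Qed.

Lemma pmf_mean_point x0 (a b : R) : 0 <= a -> 0 <= b ->
  (\esum_(x in [set: nat]) (p x * (if x == x0 then a else b))%:E <=
   (p x0 * a + (1 - p x0) * b)%:E)%E.
Proof.
move=> a0 b0; rewrite (esumID [set x0]); last first.
  by move=> x _; rewrite lee_fin mulr_ge0//; case: ifP.
rewrite !setTI esum_set1 ?lee_fin ?eqxx ?mulr_ge0// EFinD leeD//.
have pc : (\esum_(x in ~` [set x0]) (p x)%:E <= (1 - p x0)%:E)%E.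
  move: pT; rewrite (esumID [set x0]); last by move=> x _; rewrite lee_fin.
  rewrite !setTI esum_set1 ?lee_fin// => h; rewrite EFinB -h.
  by rewrite addeAC subee// add0e.
rewrite esum_mkcond; apply: (@le_trans _ _ (\esum_(x in [set: nat])
  (b%:E * (if x \in ~` [set x0] then (p x)%:E else 0)))%E).
  apply: le_esum => x _; case: ifPn => [|_]; last by rewrite mule0.
  by rewrite inE/= => /eqP/negbTE ->; rewrite mulrC EFinM.
apply: le_trans (esumZl_le b0 _) _; first by move=> x; case: ifP; rewrite ?lee_fin.
by rewrite -esum_mkcond mulrC EFinM lee_wpmul2l ?lee_fin.
Qed.

Lemma mean_le_cst n (c : R) : 0 <= c -> mean_le n (fun=> c) c.
Proof.
move=> c0; elim: n => [|n IH]; first exact: mean_le0.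
by apply: (@mean_leS _ _ (fun=> c)) => //; exact: pmf_mean_cst.
Qed.

(** The union bound over the [n] draws. *)
Lemma mean_le_has n (B : pred nat) (tau : R) : 0 <= tau ->
  (\esum_(x in [set: nat]) (p x * (B x)%:R)%:E <= tau%:E)%E ->
  mean_le n (fun s => (has B s)%:R) (n%:R * tau).
Proof.
move=> tau0 Bt; elim: n => [|n IH]; first by apply: mean_le0; rewrite //= mul0r.
apply: (@mean_leS _ _ (fun x => (B x)%:R + n%:R * tau)) => //.
- move=> x; apply: (@mean_le_mono _ _ (fun s => (B x)%:R + (has B s)%:R)).
  + by move=> s /=; case: (B x); case: (has B s) => //=; rewrite ?addr0 ?add0r// lerDl.
  + exact: lexx.
  + by apply: mean_leD => //; apply: mean_le_cst.
- under eq_esum do rewrite mulrDr EFinD.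
  rewrite esumD; last 2 first.
  + by move=> x _; rewrite lee_fin mulr_ge0.
  + by move=> x _; rewrite lee_fin !mulr_ge0.
  rewrite -addn1 natrD mulrDl mul1r addrC EFinD leeD//.
  by apply: pmf_mean_cst; rewrite mulr_ge0.
Qed.

(* The shift [a] makes the variance computation inductive in [n]. *)
Lemma mean_le_count n x0 (a : R) :
  mean_le n (fun s => ((count_mem x0 s)%:R - n%:R * p x0 + a) ^+ 2)
    (n%:R * (p x0 * (1 - p x0)) + a ^+ 2).
Proof.
have q0 : 0 <= 1 - p x0.
  rewrite subr_ge0 -lee_fin -pT -(@esum_set1 _ _ x0 (fun x => (p x)%:E)) ?lee_fin//.
  rewrite esum_mkcond; apply: le_esum => x _.
  by case: ifP => // _; rewrite lee_fin.
have v0 m : 0 <= m%:R * (p x0 * (1 - p x0)) by rewrite !mulr_ge0.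
elim: n a => [|n IH] a.
  by apply: mean_le0; rewrite /= ?sqr_ge0// !mulr0n !mul0r subr0 !add0r.
(* The first draw changes the shift to [1 - p x0 + a] or [a - p x0]. The average of these is [a], so
   the cross terms cancel and the variance of one Bernoulli draw is added. *)
apply: (@mean_leS _ _ (fun x => if x == x0
   then n%:R * (p x0 * (1 - p x0)) + (1 - p x0 + a) ^+ 2
   else n%:R * (p x0 * (1 - p x0)) + (a - p x0) ^+ 2)).
- by move=> s; rewrite sqr_ge0.
- move=> x; have [xx|xx] := boolP (x == x0).
    apply: (mean_le_mono _ _ (IH (1 - p x0 + a))) => // s /=.
    rewrite xx add1n -!natr1; by rewrite le_eqVlt; apply/orP; left; apply/eqP; ring.
  apply: (mean_le_mono _ _ (IH (a - p x0))) => // s /=.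
  rewrite (negbTE xx) add0n -!natr1; by rewrite le_eqVlt; apply/orP; left; apply/eqP; ring.
- apply: le_trans (pmf_mean_point _ _ _) _; rewrite ?addr_ge0 ?sqr_ge0//.
  by rewrite lee_fin -natr1 le_eqVlt; apply/orP; left; apply/eqP; ring.
Qed.

End iid_means.

(** * Pointwise error of the minimum distance estimator *)

Section minimum_distance_estimator.
Context {R : realType}.
Implicit Types (p q : nat -> R).

Lemma esum_count (s : seq nat) (c : R) : 0 <= c ->
  (\esum_(x in [set: nat]) (c * (count_mem x s)%:R)%:E = (c * (size s)%:R)%:E)%E.
Proof.
move=> c0; elim: s => [|y s IH].
  by rewrite esum1 ?mulr0// => x _; rewrite mulr0.
under eq_esum do rewrite /= natrD mulrDr EFinD.
rewrite esumD; last 2 first.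
- by move=> x _; rewrite lee_fin mulr_ge0.
- by move=> x _; rewrite lee_fin mulr_ge0.
rewrite IH /= -[(size s).+1]add1n natrD mulrDr EFinD; congr (_ + _)%E.
rewrite -(@esum_set1 _ _ y (fun=> (c * 1)%:E)) ?lee_fin ?mulr1//.
rewrite [RHS]esum_mkcond; apply: eq_esum => x _.
have [<-|xy] := eqVneq y x; first by rewrite mem_set//= ?mulr1.
by rewrite memNset ?mulr0//= => yx; rewrite yx eqxx in xy.
Qed.

Lemma hobs_pmf (s : seq nat) : (0 < size s)%N -> is_pmf (hobs s : nat -> R).
Proof.
move=> s0; split; first by move=> x; rewrite divr_ge0.
rewrite /hobs; under eq_esum do rewrite mulrC.
by rewrite esum_count// mulVf// pnatr_eq0 -lt0n.
Qed.

Lemma chi2_termE p q x : (q x = 0 -> p x = 0) ->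
  chi2_term p q x = ((p x - q x) ^+ 2 / q x)%:E.
Proof.
move=> qp; rewrite /chi2_term; case: eqP => [q0|//].
by rewrite q0 qp// eqxx subrr expr0n mul0r.
Qed.

(** Where [p] vanishes, the term [(p - q)^2 / q] is just [q]. *)
Lemma chi2_le p q M tau : (forall x, 0 <= q x) ->
  (forall x, q x = 0 -> p x = 0) -> (forall x, (M <= x)%N -> p x = 0) ->
  (\esum_(x in [set: nat]) (q x * (M <= x)%N%:R)%:E <= tau%:E)%E ->
  (chi2 p q <= (\sum_(x < M) (p x - q x) ^+ 2 / q x + tau)%:E)%E.
Proof.
move=> q0 qp pM qtau; rewrite /chi2.
pose a x := if (x < M)%N then (p x - q x) ^+ 2 / q x else 0.
have a0 x : 0 <= a x by rewrite /a; case: ifP => // _; rewrite divr_ge0 ?sqr_ge0.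
apply: (@le_trans _ _ (\esum_(x in [set: nat])
   ((a x)%:E + (q x * (M <= x)%N%:R)%:E))%E).
  apply: le_esum => x _; rewrite chi2_termE; last exact: qp.
  rewrite -EFinD lee_fin /a ltnNge; case: leqP => Mx /=.
    rewrite pM// sub0r sqrrN add0r mulr1.
    have [->|qx] := eqVneq (q x) 0; first by rewrite expr0n mul0r.
    by rewrite expr2 mulfK.
  by rewrite mulr0 addr0.
rewrite esumD; last 2 first.
- by move=> x _; rewrite lee_fin.
- by move=> x _; rewrite lee_fin mulr_ge0.
rewrite EFinD leeD// -nneseries_esumT; last by move=> x; rewrite lee_fin.
rewrite (@nneseries_split _ _ 0 M); last by move=> x _; rewrite lee_fin.
rewrite add0n [X in (_ + X)%E](_ : _ = 0%E); last first.
  apply: (@eseries0 _ _ M (fun=> true)) => i Mi _.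
  by rewrite /a ltnNge Mi.
rewrite adde0 big_mkord sumEFin lee_fin; apply: ler_sum => i _.
by rewrite /a ltn_ord.
Qed.

Lemma esum_ge_term (a : nat -> \bar R) x : (forall y, 0 <= a y)%E ->
  (a x <= \esum_(y in [set: nat]) a y)%E.
Proof.
move=> a0; rewrite -[leLHS](@esum_set1 _ _ x a)// esum_mkcond.
by apply: le_esum => y _; case: ifP.
Qed.

(** The termwise comparison of Hellinger with chi-square: [(a - b)^2] carries the extra factor
    [(sqrt a + sqrt b)^2 >= b]. *)
Lemma sqrt_sub_sqr_le (a b : R) : 0 <= a -> 0 <= b -> (b = 0 -> a = 0) ->
  (Num.sqrt a - Num.sqrt b) ^+ 2 <= (a - b) ^+ 2 / b.
Proof.
move=> a0 b0 ba; have [bz|bz] := eqVneq b 0.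
  by rewrite bz (ba bz) !subrr expr0n mul0r.
have bp : 0 < b by rewrite lt_neqAle eq_sym bz.
have -> : (a - b) ^+ 2 = (Num.sqrt a - Num.sqrt b) ^+ 2 *
    (Num.sqrt a + Num.sqrt b) ^+ 2 by rewrite -exprMn -subr_sqr !sqr_sqrtr.
rewrite ler_pdivlMr// ler_wpM2l ?sqr_ge0// -{1}(sqr_sqrtr b0).
by rewrite lerXn2r ?nnegrE ?addr_ge0 ?sqrtr_ge0// lerDr sqrtr_ge0.
Qed.

Variables (th : R) (g3 g4 : R) (g30 : 0 < g3) (g40 : 0 < g4).
Variables (d : (nat -> R) -> (nat -> R) -> R) (n : nat).
Variable (Qhat : n.-tuple nat -> probability R R).
Hypotheses (dg : dist_sandwich g3 g4 d) (Qmin : is_min_d_estimator th d Qhat).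

(** The empirical distribution serves as intermediate point. Its distance to [Q] costs [X]. Its
    distance to the estimator costs [2 (g4/g3) X], through lower sandwich bound, minimality and
    upper sandwich bound, the 2 coming from the half in the Hellinger distance. Then
    [(a + b)^2 <= 2 a^2 + 2 b^2] gives the constant. An observation with [hQ th Q x = 0] would make
    the chi-square infinite. *)
Lemma estimator_sqrt_close (Q : probability R R) (s : n.-tuple nat) (X : R) :
  (0 < n)%N -> supported_on th Q -> (forall x, x \in s -> hQ th Q x != 0) ->
  (chi2 (hobs s) (hQ th Q) <= X%:E)%E ->
  forall x, (Num.sqrt (hQ th Q x) - Num.sqrt (hQ th (Qhat s) x)) ^+ 2 <=
    (2 + 4 * (g4 / g3)) * X.
Proof.
move=> n0 sQ sn0 chiX x.
have [sQh Qh] := Qmin s.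
have po : is_pmf (hobs s : nat -> R) by apply: hobs_pmf; rewrite size_tuple.
have ph := hQ_pmf sQ; have phh := hQ_pmf sQh.
have h0 y : hQ th Q y = 0 -> hobs s y = 0 :> R.
  move=> hy; rewrite /hobs (_ : count_mem y s = 0%N) ?mul0r//.
  by apply/count_memPn; apply/negP => /sn0; rewrite hy eqxx.
pose o : R := Num.sqrt (hobs s x); set h := Num.sqrt (hQ th Q x).
set k := Num.sqrt (hQ th (Qhat s) x).
have oh : (o - h) ^+ 2 <= X.
  apply: le_trans (sqrt_sub_sqr_le (po.1 x) (ph.1 x) (h0 x)) _.
  rewrite -lee_fin -chi2_termE; last exact: h0.
  apply: le_trans chiX; apply: esum_ge_term => y.
  by rewrite chi2_termE ?lee_fin ?divr_ge0 ?sqr_ge0//; [exact: (ph.1 y)|exact: h0].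
have ok : g3 * (2^-1 * (o - k) ^+ 2) <= g4 * X.
  have [l1 _] := dg po phh; have [_ l2] := dg po ph.
  rewrite -lee_fin; apply: (@le_trans _ _ (g4%:E * chi2 (hobs s) (hQ th Q))%E); last first.
    by rewrite EFinM lee_wpmul2l// lee_fin ltW.
  apply: le_trans l2; apply: (@le_trans _ _ (d (hobs s) (hQ th (Qhat s)))%:E); last first.
    by rewrite lee_fin Qh.
  apply: le_trans l1; rewrite EFinM lee_wpmul2l ?lee_fin ?(ltW g30)//.
  rewrite EFinM lee_wpmul2l ?lee_fin ?invr_ge0//.
  apply: (@esum_ge_term (fun y => ((Num.sqrt (hobs s y) -
    Num.sqrt (hQ th (Qhat s) y)) ^+ 2)%:E)) => y.
  by rewrite lee_fin sqr_ge0.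
have ok' : (o - k) ^+ 2 <= 2 * (g4 / g3) * X.
  rewrite -(ler_pM2l g30); have -> : g3 * (2 * (g4 / g3) * X) = 2 * (g4 * X).
    by field; rewrite gt_eqF.
  lra.
have -> : h - k = (h - o) + (o - k) by ring.
have := sqr_ge0 ((h - o) - (o - k)).
have -> : (h - o + (o - k)) ^+ 2 = 2 * (o - h) ^+ 2 + 2 * (o - k) ^+ 2 -
   (h - o - (o - k)) ^+ 2 by ring.
move: ok' oh; set u := (o - k) ^+ 2; set v := (o - h) ^+ 2; set w := _ ^+ 2.
move: (g4 / g3) => g; lra.
Qed.

End minimum_distance_estimator.

(** * Expected loss with free parameters *)

Section expected_loss.
Context {R : realType}.
Variables (th sig : R) (th0 : 0 < th) (sig0 : 0 < sig).
Variables (Q : probability R R) (sQ : supported_on th Q).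

Local Notation h := (hQ th Q).

(** As [(x + M)! >= x! M!], the tail is at most [th^M / M!] times the series of [e^th], summed here
    as [e^th] times Poisson probabilities. *)
Lemma hQ_tail M : (\esum_(x in [set: nat]) (h x * (M <= x)%N%:R)%:E <=
  (th ^+ M / (M`!)%:R * expR th)%:E)%E.
Proof.
have h0 x : (0 <= (h x * (M <= x)%N%:R)%:E)%E.
  by rewrite lee_fin mulr_ge0// hQ_ge0.
rewrite -nneseries_esumT// (@nneseries_split _ _ 0 M)// add0n.
rewrite big1_seq ?add0e; last first.
  by move=> i; rewrite mem_index_iota => /andP[_ /andP[_ iM]]; rewrite leqNgt iM mulr0.
rewrite -nneseries_addn//.
set c := _ * expR th; have c0 : 0 <= c.
  by rewrite mulr_ge0 ?expR_ge0 ?divr_ge0 ?exprn_ge0 ?(ltW th0).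
rewrite -[leRHS]mule1 -(expR_nneseries (ltW th0)) -nneseriesZl; last first.
  by move=> x _; rewrite lee_fin pois_ge0// ltW.
apply: lee_nneseries => // x _.
rewrite -EFinM lee_fin leq_addl mulr1 (le_trans (hQ_le sQ _))//.
have -> : c * (expR (- th) * th ^+ x / (x`!)%:R) =
    th ^+ (x + M) * ((M`!)%:R^-1 * (x`!)%:R^-1).
  have := expRxMexpNx_1 th; rewrite /c exprD.
  move: (expR th) (expR (- th)) => a b ab.
  have -> (e f i j : R) : e * f * a * (b * i * j) = i * e * (f * j) * (a * b) by ring.
  by rewrite ab mulr1.
rewrite ler_wpM2l ?exprn_ge0 ?(ltW th0)// -invfM.
rewrite lef_pV2 ?posrE ?mulr_gt0 ?ltr0n ?fact_gt0// -natrM ler_nat addnC.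
exact: fact_dvd_bound.
Qed.

(* The full chi-square between the empirical distribution and [h] has infinite
   mean, each of its terms contributing [(1 - h x) / n]; beyond [M] it reduces
   to the mass of [h] unless some observation reaches [M]. The division by
   [h x = 0] harmlessly gives [0]. *)
Definition trunc_chi2 n M (s : seq nat) : R :=
  \sum_(x < M) ((count_mem (x : nat) s)%:R / n%:R - h x) ^+ 2 / h x.

Lemma trunc_chi2_ge0 n M s : 0 <= trunc_chi2 n M s.
Proof. by apply: sumr_ge0 => x _; rewrite divr_ge0 ?sqr_ge0 ?hQ_ge0. Qed.

Lemma mean_trunc_chi2 n M : (0 < n)%N ->
  mean_le h n (trunc_chi2 n M) (M%:R / n%:R).
Proof.
move=> n0; have pmf := hQ_pmf sQ.
have nz : n%:R != 0 :> R by rewrite pnatr_eq0 -lt0n.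
elim: M => [|M IH].
  apply: (mean_le_mono pmf _ _ (mean_le_cst pmf n (lexx 0))).
    by move=> s; rewrite /trunc_chi2 big_ord0.
  by rewrite mul0r.
pose v s : R := ((count_mem M s)%:R - n%:R * h M + 0) ^+ 2.
pose c := (n%:R ^+ 2 * h M)^-1.
have c0 : 0 <= c by rewrite invr_ge0 mulr_ge0 ?sqr_ge0 ?hQ_ge0.
have vM := mean_leZ pmf c0 (fun s => sqr_ge0 _) (mean_le_count pmf n M 0).
apply: (mean_le_mono pmf _ _ (mean_leD pmf (trunc_chi2_ge0 n M) _ IH vM)).
- move=> s; rewrite /trunc_chi2 big_ord_recr/= lerD2l.
  have [->|hM] := eqVneq (h M) 0; first by rewrite invr0 mulr0 mulr_ge0 ?sqr_ge0.
  by rewrite le_eqVlt /c; apply/orP; left; apply/eqP; field; rewrite hM nz.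
- rewrite -(natr1 M) mulrDl lerD2l expr0n addr0 mul1r /c.
  have [->|hM] := eqVneq (h M) 0; first by rewrite mulr0 invr0 mul0r invr_ge0.
  have -> : (n%:R ^+ 2 * h M)^-1 * (n%:R * (h M * (1 - h M))) = (1 - h M) / n%:R.
    by field; rewrite hM nz.
  by rewrite ler_piMl ?invr_ge0// gerBl hQ_ge0.
- by move=> s; rewrite mulr_ge0 ?sqr_ge0.
Qed.

Variables (g3 g4 : R) (g30 : 0 < g3) (g40 : 0 < g4).
Variables (d : (nat -> R) -> (nat -> R) -> R) (n : nat).
Variable (Qhat : n.-tuple nat -> probability R R).
Hypotheses (dg : dist_sandwich g3 g4 d) (Qmin : is_min_d_estimator th d Qhat).
Hypothesis (n0 : (0 < n)%N).

Variables (rho : R) (k M : nat) (tau delta : R).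
Hypotheses (rho1 : 1 <= rho) (rhoE : 2 * Num.sqrt th / sig <= rho).
Hypotheses (tau0 : 0 <= tau) (delta0 : 0 < delta).
Hypothesis tail : th ^+ M / (M`!)%:R * expR th <= tau.

Let c0 : R := 2 + 4 * (g4 / g3).
Let c00 : 0 <= c0.
Proof. by rewrite addr_ge0// mulr_ge0// divr_ge0 ?(ltW g30) ?(ltW g40). Qed.

Let htail : (\esum_(x in [set: nat]) (h x * (M <= x)%N%:R)%:E <= tau%:E)%E.
Proof. by apply: le_trans (hQ_tail M) _; rewrite lee_fin. Qed.

(** The error is [sqrt (c0 X)], but only the mean of [X] is controlled;
    [sqrt z <= (delta + z/delta)/2] makes it linear in [X]. The indicator covers samples reaching
    [M], where square roots of probabilities differ by at most 1. *)
Let eps (s : seq nat) : R := (has (leq M) s)%:R +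
  (delta + c0 * (trunc_chi2 n M s + tau) / delta) / 2.

Let X0 s : 0 <= trunc_chi2 n M s + tau.
Proof. by rewrite addr_ge0 ?trunc_chi2_ge0. Qed.

Let eps_pos s : 0 <= (delta + c0 * (trunc_chi2 n M s + tau) / delta) / 2.
Proof.
rewrite divr_ge0// addr_ge0 ?(ltW delta0)// divr_ge0 ?(ltW delta0)//.
by rewrite mulr_ge0.
Qed.

Let eps_ge0 s : 0 <= eps s. Proof. by rewrite addr_ge0. Qed.

(** Nonzero weight puts every observation in the support of [h]; samples of zero weight contribute
    nothing to the expectation. *)
Let hellinger_eps (s : n.-tuple nat) : iid_weight h s != 0 ->
  forall x, `|Num.sqrt (h x) - Num.sqrt (hQ th (Qhat s) x)| <= eps s.
Proof.
move=> ws x; rewrite /eps; have [big|small] := boolP (has (leq M) s).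
  have le01 (P : probability R R) y : supported_on th P ->
      0 <= Num.sqrt (hQ th P y) <= 1.
    move=> sP; rewrite sqrtr_ge0/= -[leRHS]sqrtr1 ler_sqrt//; exact: hQ_le1.
  have /andP[a0 a1] := le01 _ x sQ.
  have /andP[b0 b1] := le01 _ x (proj1 (Qmin s)).
  rewrite -[leLHS]addr0 lerD//= mulr1n ler_norml; apply/andP; split; lra.
have hs y : y \in tval s -> h y != 0.
  move=> ys; apply: contraNneq ws => hy; rewrite /iid_weight.
  by rewrite (big_rem y)//= hy mul0r.
have chiX : (chi2 (hobs s) h <= (trunc_chi2 n M s + tau)%:E)%E.
  have -> : trunc_chi2 n M s = \sum_(y < M) (hobs s y - h y) ^+ 2 / h y.
    by rewrite /trunc_chi2 /hobs size_tuple.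
  apply: chi2_le htail; first exact: hQ_ge0.
  - move=> y hy; rewrite /hobs (_ : count_mem y s = 0%N) ?mul0r//.
    by apply/count_memPn; apply/negP => /hs; rewrite hy eqxx.
  - move=> y My; rewrite /hobs (_ : count_mem y s = 0%N) ?mul0r//.
    apply/count_memPn; apply: contraNN small => ys.
    by apply/hasP; exists y.
have := estimator_sqrt_close g30 g40 dg Qmin n0 sQ hs chiX x.
rewrite -/c0; move: (X0 s); set X := _ + tau => X0' sq.
rewrite add0r.
set u := Num.sqrt _ - _ in sq *; rewrite ler_pdivlMr//.
have u2 : `|u| ^+ 2 = u ^+ 2 by rewrite -normrX ger0_norm ?sqr_ge0.
have : 0 <= (`|u| - delta) ^+ 2 / delta by rewrite divr_ge0 ?sqr_ge0 ?(ltW delta0).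
have -> : (`|u| - delta) ^+ 2 / delta = `|u| ^+ 2 / delta - 2 * `|u| + delta.
  by field; rewrite gt_eqF.
have : `|u| ^+ 2 / delta <= c0 * X / delta.
  by rewrite u2 ler_wpM2r ?invr_ge0 ?(ltW delta0).
move: (_ / delta) (_ / delta) => a b; lra.
Qed.

Let amp : R := k%:R ^+ 2 * rho ^+ (3 * k).
Let rem : R := trunc_base th sig ^+ k / Num.sqrt (k`!)%:R.

Let amp0 : 0 <= amp.
Proof. by rewrite mulr_ge0 ?sqr_ge0// exprn_ge0// (le_trans ler01). Qed.

Let rem0 : 0 <= rem.
Proof. by rewrite divr_ge0 ?sqrtr_ge0 ?exprn_ge0 ?(ltW (trunc_base_gt0 _ _)). Qed.

Lemma expected_W1_le : (expected_W1 th sig Q Qhat <=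
  (W1sigma_const th sig * (amp * (n%:R * tau +
     (delta + c0 * (M%:R / n%:R + tau) / delta) / 2) + rem))%:E)%E.
Proof.
have pmf := hQ_pmf sQ; have K0 := ltW (W1sigma_const_gt0 th sig).
apply: (@le_trans _ _ (\esum_(s in [set: n.-tuple nat])
   (iid_weight h s * (W1sigma_const th sig * (amp * eps s + rem)))%:E)%E).
  apply: le_esum => s _; rewrite -/(iid_weight h s).
  have w0 := iid_weight_ge0 pmf s.
  have [->|ws] := eqVneq (iid_weight h s) 0; first by rewrite mul0e mul0r.
  rewrite EFinM lee_wpmul2l ?lee_fin//.
  exact: (W1sigma_le_hellinger th0 sig0 k sQ (proj1 (Qmin s)) rho1 rhoE
    (hellinger_eps ws)).
rewrite -/(mean_le h n (fun s => W1sigma_const th sig * (amp * eps s + rem)) _).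
apply: mean_leZ => //.
  by move=> s; apply: addr_ge0 => //; apply: mulr_ge0.
apply: mean_leD => //; last exact: mean_le_cst.
  by move=> s; apply: mulr_ge0.
apply: mean_leZ => //; apply: mean_leD => //.
  exact: mean_le_has.
pose a := c0 / delta / 2.
have a0 : 0 <= a by rewrite !divr_ge0// ltW.
have e0 : 0 <= delta / 2 + a * tau by apply: addr_ge0; apply: mulr_ge0 => //; rewrite ltW.
apply: (mean_le_mono pmf _ _ (mean_leD pmf _ _
  (mean_leZ pmf a0 (trunc_chi2_ge0 n M) (mean_trunc_chi2 M n0))
  (mean_le_cst pmf n e0))).
- by move=> s; rewrite le_eqVlt; apply/orP; left; apply/eqP; rewrite /a; field; rewrite gt_eqF.
- rewrite le_eqVlt; apply/orP; left; apply/eqP; rewrite /a; field.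
  by rewrite gt_eqF// pnatr_eq0 -lt0n n0.
- by move=> s; rewrite mulr_ge0 ?trunc_chi2_ge0.
- by move=> s.
Qed.

End expected_loss.

(** * Choice of the cutoff and of the truncation order *)

Section parameter_choice.
Context {R : realType}.

(** From [m^m / m! <= e^m], a single term of the series of [e^m]. *)
Lemma pow_fact_le (x lam : R) m : 0 <= x -> x * expR (1 + lam) <= m%:R ->
  x ^+ m / (m`!)%:R <= expR (- (lam * m%:R)).
Proof.
move=> x0 xm.
apply: (@le_trans _ _ ((m%:R * expR (- (1 + lam))) ^+ m / (m`!)%:R)).
  rewrite ler_wpM2r ?invr_ge0// lerXn2r ?nnegrE ?mulr_ge0 ?expR_ge0//.
  by rewrite expRN ler_pdivlMr ?expR_gt0.
rewrite exprMn mulrAC -expRM_natl.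
have := expR_ge_term m (ler0n R m).
rewrite -(ler_pM2r (expR_gt0 (m%:R * - (1 + lam)))) => /le_trans; apply.
rewrite -expRD ler_expR le_eqVlt; apply/orP; left; apply/eqP; ring.
Qed.

Variables (th sig : R) (th0 : 0 < th) (sig0 : 0 < sig).

(** The summands serve in turn [l >= 1], the ratio condition for the Poisson tail, the absorption of
    [e^th] there, and the absorption of [trunc_base^2 e] by [e^(l/4)] in the remainder. *)
Definition large_threshold : R :=
  1 + th * expR 2 + 2 * th + 4 * (trunc_base th sig ^+ 2 * expR 1).

Variables (l : R) (ll : large_threshold <= l).
Local Notation L := (expR l).

Let D2 : 0 <= trunc_base th sig ^+ 2 * expR 1.
Proof. by rewrite mulr_ge0 ?sqr_ge0 ?expR_ge0. Qed.

Let e2 : 0 <= th * expR 2.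
Proof. by rewrite mulr_ge0 ?expR_ge0 ?(ltW th0). Qed.

Lemma threshold_ge1 : 1 <= l.
Proof. move: ll th0 D2 e2; rewrite /large_threshold; lra. Qed.

Let lL : l + 1 <= L. Proof. by rewrite addrC expR_ge1Dx. Qed.

Lemma L_ge1 : 1 <= L. Proof. move: lL threshold_ge1; lra. Qed.

(* With [L = log n] and [l = log log n], the order [5 L / l] makes
   [trunc_order!] at least of order [n^4], while an amplification by a constant
   to the power [3 * trunc_order] costs only [n^(O(1 / l))]. *)
Definition poisson_cutoff : nat := (Num.truncn (2 * L)).+1.
Definition trunc_order : nat := Num.truncn (5 * L / l).

Lemma poisson_cutoff_le : poisson_cutoff%:R <= 2 * L + 1.
Proof.
have /truncn_itv/andP[h _] : 0 <= 2 * L by rewrite mulr_ge0 ?expR_ge0.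
by rewrite /poisson_cutoff -natr1 lerD2r.
Qed.

Lemma poisson_cutoff_ge : 2 * L <= poisson_cutoff%:R.
Proof.
have /truncn_itv/andP[_ h] : 0 <= 2 * L by rewrite mulr_ge0 ?expR_ge0.
exact: ltW.
Qed.

(** A tail of [n^(-3/2)] keeps the union bound over [n] draws at [n^(-1/2)]. The cutoff [2 L] gives
    [n^(-2)], and half a power is given up to absorb [e^th]. *)
Lemma poisson_tail_le :
  th ^+ poisson_cutoff / (poisson_cutoff`!)%:R * expR th <= expR (- (3 / 2 * L)).
Proof.
have M2 := poisson_cutoff_ge.
have h : th * expR (1 + 1) <= poisson_cutoff%:R.
  move: lL ll th0 D2 M2 threshold_ge1; rewrite /large_threshold.
  move: e2 L => e2' L'; rewrite (_ : 1 + 1 = 2 :> R)//.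
  by move: e2'; move: (th * expR 2) (_ * expR 1) => a b; lra.
apply: le_trans (ler_wpM2r (expR_ge0 _) (pow_fact_le (ltW th0) h)) _.
rewrite -expRD ler_expR mul1r.
move: lL ll th0 D2 e2 M2 threshold_ge1; rewrite /large_threshold.
move: (th * expR 2) (_ * expR 1) => a b; lra.
Qed.

Let l0 : 0 < l. Proof. by rewrite (lt_le_trans ltr01 threshold_ge1). Qed.

Lemma trunc_order_le : trunc_order%:R <= 5 * L / l.
Proof.
have /truncn_itv/andP[//] : 0 <= 5 * L / l.
by rewrite divr_ge0 ?mulr_ge0 ?expR_ge0 ?(ltW l0).
Qed.

(** Rounding down loses at most 1, and [1 <= L/l]. *)
Lemma trunc_order_ge : 4 * L / l <= trunc_order%:R.
Proof.
have /truncn_itv/andP[_] : 0 <= 5 * L / l.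
  by rewrite divr_ge0 ?mulr_ge0 ?expR_ge0 ?(ltW l0).
rewrite -/trunc_order -natr1 -!mulrA.
have : 1 <= L / l by rewrite ler_pdivlMr// mul1r; move: lL; lra.
move: (L / l) => z; lra.
Qed.

(** The square is bounded by [pow_fact_le] with rate [l/4], giving [e^(-(l/4) k) <= e^(-L)] as
    [k >= 4 L/l]. *)
Lemma trunc_remainder_le :
  trunc_base th sig ^+ trunc_order / Num.sqrt (trunc_order`!)%:R <=
  expR (- (L / 2)).
Proof.
have k4 := trunc_order_ge.
have D0 := ltW (trunc_base_gt0 th0 sig0).
have h : trunc_base th sig ^+ 2 * expR (1 + l / 4) <= trunc_order%:R.
  apply: le_trans k4; rewrite ler_pdivlMr// expRD mulrA.
  have b4 : trunc_base th sig ^+ 2 * expR 1 <= expR (l / 4).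
    have := expR_ge1Dx (l / 4).
    move: ll th0 D2 e2; rewrite /large_threshold.
    move: (th * expR 2) (_ * expR 1) (expR (l / 4)) => a b c; lra.
  (* One [e^(l/4)] absorbs [trunc_base^2 e], the second is the rate factor of [pow_fact_le], and
     [4 e^(l/2)] absorbs the denominator [l]. *)
  have -> : L = expR (l / 4) * expR (l / 4) * expR (l / 2).
    by rewrite -!expRD; congr expR; field.
  have l2 : l <= 4 * expR (l / 2).
    have := expR_ge1Dx (l / 2); move: l0; move: (expR _) => a; lra.
  have c0 := expR_ge0 (l / 4); have e0 := expR_ge0 (l / 2).
  have -> : 4 * (expR (l / 4) * expR (l / 4) * expR (l / 2)) =
    expR (l / 4) * expR (l / 4) * (4 * expR (l / 2)) by ring.
  apply: ler_pM => //; last exact: ler_wpM2r.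
    by rewrite mulr_ge0.
  exact: ltW.
have q := pow_fact_le (sqr_ge0 _) h.
rewrite -ler_sqr ?nnegrE ?expR_ge0 ?divr_ge0 ?exprn_ge0 ?sqrtr_ge0//.
rewrite exprMn exprVn sqr_sqrtr// exprAC; apply: le_trans q _.
rewrite -expRM_natl ler_expR.
have -> : 2%:R * - (L / 2) = - L by field.
rewrite lerN2; have {1}-> : L = l / 4 * (4 * L / l) by field; rewrite gt_eqF.
by rewrite ler_wpM2l// divr_ge0// ltW.
Qed.

(** After squaring, the exponent is at most [(3 * 5 / 8) c L/l], and [15/8 <= 2]. *)
Lemma ampl_le (rho c : R) : 1 <= rho -> rho ^+ 2 <= expR (c / 8) -> 0 <= c ->
  rho ^+ (3 * trunc_order) <= expR (c * (L / l)).
Proof.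
move=> rho1 rhoc c0.
rewrite -ler_sqr ?nnegrE ?expR_ge0 ?exprn_ge0 ?(le_trans ler01)//.
rewrite exprAC; apply: (@le_trans _ _ (expR (c / 8) ^+ (3 * trunc_order))).
  by rewrite lerXn2r ?nnegrE ?sqr_ge0 ?expR_ge0.
rewrite -!expRM_natl ler_expR natrM.
have := trunc_order_le; rewrite -mulrA; set k0 := trunc_order; move: (L / l) => z kz.
have : 0 <= c * (5 * z - k0%:R) by rewrite mulr_ge0// subr_ge0.
have : 0 <= c * z by apply: mulr_ge0 c0 _; move: (ler0n R k0) kz; lra.
lra.
Qed.

End parameter_choice.

(** * The rate in terms of [log n] *)

Section explicit_rate.
Context {R : realType}.
Variables (th sig g3 g4 : R).
Hypotheses (th0 : 0 < th) (sig0 : 0 < sig) (g30 : 0 < g3) (g40 : 0 < g4).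

(** Here 25 comes from [k^2 <= 25 L^2], [2 + 4 c0] from the mean Hellinger error with
    [c0 = 2 + 4 g4/g3], and the final 1 from the truncation remainder. *)
Definition rate_const : R :=
  W1sigma_const th sig * (25 * (2 + 4 * (2 + 4 * (g4 / g3))) + 1).

Lemma rate_const_gt0 : 0 < rate_const.
Proof.
have g0 : 0 < g4 / g3 by rewrite divr_gt0.
by rewrite mulr_gt0 ?W1sigma_const_gt0//; move: (g4 / g3) g0 => g; lra.
Qed.

Variables (d : (nat -> R) -> (nat -> R) -> R) (n : nat).
Variable (Qhat : n.-tuple nat -> probability R R).
Hypotheses (dg : dist_sandwich g3 g4 d) (Qmin : is_min_d_estimator th d Qhat).
Variables (l rho : R).
Hypotheses (ll : large_threshold th sig <= l) (nl : n%:R = expR (expR l)).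
Hypotheses (rho1 : 1 <= rho) (rhoE : 2 * Num.sqrt th / sig <= rho).

(** Of the three powers of [L], two come from [k^2] and one from the number of cells below the
    Poisson cutoff. *)
Lemma expected_W1_rate (Q : probability R R) : supported_on th Q ->
  (expected_W1 th sig Q Qhat <=
   (rate_const * expR (- (expR l / 2)) * rho ^+ (3 * trunc_order l) *
     expR l ^+ 3)%:E)%E.
Proof.
move=> sQ.
have n0 : (0 < n)%N by rewrite -(ltr0n R) nl expR_gt0.
set L := expR l; set E := expR (- (L / 2)).
set M := poisson_cutoff l; set tau := th ^+ M / (M`!)%:R * expR th.
have E0 : 0 < E by exact: expR_gt0.
have tau0 : 0 <= tau.
  by rewrite mulr_ge0 ?expR_ge0 ?divr_ge0 ?exprn_ge0 ?(ltW th0).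
(* Taking [delta = n^(-1/2)] balances [delta] against [(L/n)/delta] up to the factor [L]. *)
apply: le_trans (expected_W1_le th0 sig0 sQ g30 g40 dg Qmin n0 (trunc_order l)
  rho1 rhoE tau0 E0 (lexx tau)) _.
rewrite lee_fin /rate_const.
have -> (a b e f g : R) : a * b * e * f * g = a * (b * (e * (f * g))) by ring.
rewrite ler_wpM2l ?(ltW (W1sigma_const_gt0 _ _))//.
have g0 : 0 < g4 / g3 by rewrite divr_gt0.
set c0 := 2 + 4 * (g4 / g3); have c00 : 0 <= c0 by rewrite /c0; move: (g4 / g3) g0 => g; lra.
have L1 : 1 <= L := L_ge1 th0 ll.
have L0 : 0 <= L := expR_ge0 l.
have l1 : 1 <= l := threshold_ge1 th0 ll.
have nE : n%:R * (E * E) = 1.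
  rewrite nl -/L /E -!expRD -[RHS]expR0; congr expR.
  by field.
have nz : n%:R != 0 :> R by rewrite pnatr_eq0 -lt0n.
have nV : n%:R^-1 = E * E by apply: (mulfI nz); rewrite nE mulfV.
have E1 : E <= 1 by rewrite -expR0 ler_expR oppr_le0 divr_ge0 ?expR_ge0.
have tE : tau <= E * E * E.
  have -> : E * E * E = expR (- (3 / 2 * L)).
    by rewrite /E -!expRD; congr expR; field.
  exact: (poisson_tail_le th0 ll).
have ntau : n%:R * tau <= E.
  apply: le_trans (ler_wpM2l (ler0n _ _) tE) _.
  by rewrite mulrA nE mul1r.
have tau1 : tau <= E * E.
  by apply: le_trans tE _; rewrite ler_piMr// mulr_ge0 ?ltW.
have ME : M%:R * n%:R^-1 + tau <= (2 * L + 2) * (E * E).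
  have -> : (2 * L + 2) * (E * E) = (2 * L + 1) * (E * E) + E * E by ring.
  by rewrite nV lerD// ler_wpM2r ?mulr_ge0 ?(ltW E0)// poisson_cutoff_le.
set P := rho ^+ _; have P1 : 1 <= P by rewrite exprn_ege1.
have bias : n%:R * tau + (E + c0 * (M%:R * n%:R^-1 + tau) * E^-1) * 2^-1 <=
    E * L * (2 + 4 * c0).
  have h : c0 * (M%:R * n%:R^-1 + tau) * E^-1 <= c0 * (2 * L + 2) * E.
    rewrite ler_pdivrMr//.
    have -> : c0 * (2 * L + 2) * E * E = c0 * ((2 * L + 2) * (E * E)) by ring.
    by rewrite ler_wpM2l.
  move: h; set z := c0 * _ * E^-1 => h.
  have h1 : 0 <= E * (L - 1) by rewrite mulr_ge0 ?subr_ge0 ?(ltW E0).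
  have h2 : 0 <= c0 * E * (L - 1) by rewrite !mulr_ge0 ?subr_ge0 ?(ltW E0).
  have h3 : 0 <= c0 * E * L by apply: mulr_ge0 => //; apply: mulr_ge0 => //; exact: ltW.
  move: ntau h h1 h2 h3; move: (n%:R * tau) => y; lra.
have k5 : (trunc_order l)%:R <= 5 * L.
  apply: le_trans (trunc_order_le th0 ll) _.
  by rewrite ler_piMr ?mulr_ge0 ?expR_ge0// invf_le1 ?(lt_le_trans ltr01).
have k2 : (trunc_order l)%:R ^+ 2 <= 25 * L ^+ 2.
  have -> : 25 * L ^+ 2 = (5 * L) ^+ 2 by ring.
  by rewrite lerXn2r ?nnegrE ?mulr_ge0 ?expR_ge0.
have P0 : 0 <= P := le_trans ler01 P1.
have -> : (25 * (2 + 4 * c0) + 1) * (E * (P * L ^+ 3)) =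
    25 * L ^+ 2 * P * (E * L * (2 + 4 * c0)) + E * (P * L ^+ 3) by ring.
apply: lerD.
  apply: ler_pM => //.
  - by rewrite mulr_ge0 ?sqr_ge0.
  - have z0 : 0 <= M%:R * n%:R^-1 + tau by rewrite addr_ge0// divr_ge0.
    apply: addr_ge0; first by rewrite mulr_ge0.
    rewrite mulr_ge0// addr_ge0 ?(ltW E0)// mulr_ge0 ?invr_ge0 ?(ltW E0)//.
    by rewrite mulr_ge0.
  - by rewrite ler_wpM2r.
apply: le_trans (trunc_remainder_le th0 sig0 ll) _.
rewrite -/L -/E ler_peMr ?(ltW E0)//.
by rewrite -[leLHS]mulr1 ler_pM// exprn_ege1.
Qed.

End explicit_rate.

Theorem theorem4 (R : realType) (th sig g3 g4 : R) :
  0 < th -> 0 < sig -> 0 < g3 -> 0 < g4 ->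
  let c := 8 * ln (4 * th / sig ^+ 2) in
  exists C : R, 0 < C /\ exists a : R, 0 < a /\ exists N : nat,
  forall (d : (nat -> R) -> (nat -> R) -> R),
    gen_distance d -> dist_sandwich g3 g4 d ->
  forall n : nat, (N <= n)%N ->
  forall Qhat : n.-tuple nat -> probability R R,
    is_min_d_estimator th d Qhat ->
  forall Q : probability R R, supported_on th Q ->
    (expected_W1 th sig Q Qhat <=
      (if sig ^+ 2 < 4 * th then
         C * n%:R `^ (- 2^-1 + c / ln (ln n%:R)) * (ln n%:R) `^ a
       else
         C * n%:R `^ (- 2^-1) * (ln n%:R) `^ a)%:E)%E.
Proof.
move=> th0 sig0 g30 g40 c.
exists (rate_const th sig g3 g4); split; first exact: rate_const_gt0.
exists 3; split=> //.
exists (Num.truncn (expR (expR (large_threshold th sig)))).+1.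
move=> d _ dg n Nn Qhat Qmin Q sQ.
have n_large : expR (expR (large_threshold th sig)) <= n%:R.
  have /truncn_itv/andP[_ h] := expR_ge0 (expR (large_threshold th sig)).
  by rewrite (le_trans (ltW h))// ler_nat.
have n0 : 0 < (n%:R : R) by rewrite (lt_le_trans (expR_gt0 _) n_large).
have ln_large : expR (large_threshold th sig) <= ln n%:R.
  by rewrite -ler_expR lnK ?posrE.
have ln0 : 0 < ln (n%:R : R) by rewrite (lt_le_trans (expR_gt0 _) ln_large).
set l := ln (ln (n%:R : R)).
have lE : expR l = ln n%:R by rewrite lnK ?posrE.
have ll : large_threshold th sig <= l by rewrite -ler_expR lE.
have nl : n%:R = expR (expR l) by rewrite lE lnK ?posrE.
have powE (x : R) : n%:R `^ x = expR (x * ln n%:R).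
  by rewrite /powR (gt_eqF n0).
have L3 : (ln n%:R) `^ 3 = expR l ^+ 3 by rewrite lE powR_mulrn// ltW.
have rate rho := @expected_W1_rate _ _ _ _ _ th0 sig0 g30 g40 d n Qhat dg Qmin
  l rho ll nl.
have q0 : 0 < 4 * th / sig ^+ 2 by rewrite divr_gt0 ?mulr_gt0 ?exprn_gt0.
have r2 : (2 * Num.sqrt th / sig) ^+ 2 = 4 * th / sig ^+ 2.
  rewrite !exprMn exprVn sqr_sqrtr ?(ltW th0)//; ring.
have r0 : 0 <= 2 * Num.sqrt th / sig.
  by rewrite divr_ge0 ?mulr_ge0 ?sqrtr_ge0 ?(ltW sig0).
have C0 := rate_const_gt0 th sig g30 g40.
have hE : expR (- (expR l / 2)) = n%:R `^ (- 2^-1).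
  by rewrite powE lE; congr expR; ring.
(* When [sig^2 >= 4 th], [rho = 1] is admissible and nothing is amplified; otherwise
   [rho = 2 sqrt th / sig], so [rho^2 = e^(c/8)]. *)
case: ifPn => [lt4|]; last first.
  rewrite -leNgt => ge4.
  have r1 : 2 * Num.sqrt th / sig <= 1.
    by rewrite -ler_sqr ?nnegrE// r2 expr1n ler_pdivrMr ?exprn_gt0// mul1r.
  apply: le_trans (rate 1 (lexx 1) r1 Q sQ) _.
  by rewrite expr1n mulr1 lee_fin hE L3.
have q1 : 1 <= 4 * th / sig ^+ 2 by rewrite ler_pdivlMr ?exprn_gt0// mul1r ltW.
have r1 : 1 <= 2 * Num.sqrt th / sig by rewrite -ler_sqr ?nnegrE// expr1n r2.
apply: le_trans (rate _ r1 (lexx _) Q sQ) _.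
rewrite lee_fin L3 powRD; last by rewrite (gt_eqF n0) implybT.
rewrite -hE mulrA.
apply: ler_wpM2r; first by rewrite exprn_ge0 ?expR_ge0.
apply: ler_wpM2l; first by rewrite mulr_ge0 ?expR_ge0 ?ltW.
have -> : n%:R `^ (c / l) = expR (c * (expR l / l)).
  by rewrite powE lE mulrAC mulrA.
apply: (ampl_le th0 ll r1).
- have -> : c / 8 = ln (4 * th / sig ^+ 2) by rewrite /c; field.
  by rewrite r2 lnK ?posrE.
- by rewrite mulr_ge0 ?ln_ge0.
Qed.
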